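(* Let $k\ge 1$ and $g>k$. Then the image of the homomorphism $J_k^L:\mathcal F_k^L(\mathcal M_{g,1})\to \mathsf D_k(H_g')$ contains $2\,\mathsf D_k(H_g')$, and so is a subgroup of $\mathsf D_k(H_g')$ of index a power of $2$. If, in addition, $k$ is odd, then $J_k^L$ is onto $\mathsf D_k(H_g')$.
   Context: $\Sigma_{g,1}$ is the compact oriented surface of genus $g$ with one boundary component, $\Sigma_g$ the closed oriented surface obtained by attaching a disk, and $\mathcal M_{g,1}$ the mapping class group of $\Sigma_{g,1}$: isotopy classes rel boundary of orientation-preserving diffeomorphisms which are the identity on $\partial\Sigma_{g,1}$. $F=\pi_1(\Sigma_{g,1})$ is free on $x_1,\dots,x_g,y_1,\dots,y_g$, representing a system of meridian and longitude curves, and $\mathcal M_{g,1}$ is identified (Dehn–Nielsen–Baer) with the group of automorphisms of $F$ fixing $\delta=[x_1,y_1]\cdots[x_g,y_g]$; write $h_*$ for the automorphism induced by $h$. $T_g$ is a handlebody bounded by $\Sigma_g$, $i:\Sigma_{g,1}\to T_g$ is the inclusion, and the basis is chosen so that the $x_j$ are null-homotopic in $T_g$, and hence $i_*(y_1),\dots,i_*(y_g)$ is a basis of the free group $F'=\pi_1(T_g)$. For a group $G$, $G_q$ denotes the $q$-th term of its lower central series ($G_1=G$). $H_g=H_1(\Sigma_{g,1})=F/F_2$ with its symplectic (intersection) form, for which $\{x_j,y_j\}$ is a symplectic basis; $H_g'=H_1(T_g)=F'/F'_2$; $L=\ker(H_g\to H_g')$. For a free abelian group $V$, $\mathsf L(V)=\bigoplus_q\mathsf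 L_q(V)$ is the free Lie algebra over $\mathbb Z$ on $V$, and $\mathsf D_k(V)$ is the kernel of the bracket map $V\otimes\mathsf L_{k+1}(V)\to\mathsf L_{k+2}(V)$. One has $F'_q/F'_{q+1}\cong\mathsf L_q(H_g')$. The Lagrangian filtration: for $k\ge1$, $\mathcal F_k^L(\mathcal M_{g,1})$ is the subgroup of all $h\in\mathcal M_{g,1}$ such that for all $j$: (1) $i_*h_*(x_j)\in F'_{k+1}$, and (2) $h_*(x_j)\equiv x_j \bmod F_2$. The homomorphism $J_k^L:\mathcal F_k^L(\mathcal M_{g,1})\to\operatorname{Hom}(L,\mathsf L_{k+1}(H_g'))\cong H_g'\otimes\mathsf L_{k+1}(H_g')$ (isomorphism induced by the symplectic form on $H_g$, which identifies the dual of $L$ with $H_g/L=H_g'$) is defined as follows: for $h\in\mathcal F_k^L(\mathcal M_{g,1})$ and $l\in L$, choose $\lambda\in\ker(i_*:F\to F')$ representing $l$, and let $J_k^L(h)\cdot l$ be the class of $i_*h_*(\lambda)$ in $F'_{k+1}/F'_{k+2}\cong\mathsf L_{k+1}(H_g')$. It is known that this is a well-defined homomorphism with kernel $\mathcal F_{k+1}^L(\mathcal M_{g,1})$ and that its image is contained in $\mathsf D_k(H_g')$. *)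

(* Defs.v *)
From HB Require Import structures.
From mathcomp Require Import all_boot all_order all_algebra.
From mathcomp Require Import boolp.

Set Implicit Arguments.
Unset Strict Implicit.
Unset Printing Implicit Defensive.

Import GRing.Theory.
Local Open Scope quotient_scope.
Local Open Scope ring_scope.

(** The letter [(t, false)] is the generator [t], [(t, true)] is its inverse. *)
Inductive word_eq (T : Type) : seq (T * bool) -> seq (T * bool) -> Prop :=
| word_eq_refl w : word_eq w w
| word_eq_sym w1 w2 : word_eq w1 w2 -> word_eq w2 w1
| word_eq_trans w1 w2 w3 : word_eq w1 w2 -> word_eq w2 w3 -> word_eq w1 w3
| word_eq_cat w1 w2 w3 w4 :
    word_eq w1 w2 -> word_eq w3 w4 -> word_eq (w1 ++ w3) (w2 ++ w4)
| word_eq_cancel t b : word_eq [:: (t, b); (t, ~~ b)] [::].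

Section FreeGroup.
Variable T : choiceType.

Definition word_eqb (w1 w2 : seq (T * bool)) : bool := `[< word_eq w1 w2 >].

Lemma word_eqb_refl : reflexive word_eqb.
Proof. by move=> w; apply/asboolP; exact: word_eq_refl. Qed.
Lemma word_eqb_sym : symmetric word_eqb.
Proof. by move=> w1 w2; apply/asboolP/asboolP; exact: word_eq_sym. Qed.
Lemma word_eqb_trans : transitive word_eqb.
Proof.
move=> w2 w1 w3 /asboolP h1 /asboolP h2; apply/asboolP.
exact: word_eq_trans h1 h2.
Qed.

Canonical word_equiv := EquivRel word_eqb word_eqb_refl word_eqb_sym
  word_eqb_trans.

Definition free_group := {eq_quot word_equiv}.
HB.instance Definition _ := EqQuotient.on free_group.
HB.instance Definition _ := Choice.on free_group.

Lemma free_group_eqP (w1 w2 : seq (T * bool)) :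
  \pi_free_group w1 = \pi_free_group w2 <-> word_eq w1 w2.
Proof.
split; first by move/eqmodP => /asboolP.
by move=> h; apply/eqmodP/asboolP.
Qed.

Lemma repr_word (w : seq (T * bool)) : word_eq (repr (\pi_free_group w)) w.
Proof. by apply/free_group_eqP; rewrite reprK. Qed.

Definition word_inv (w : seq (T * bool)) : seq (T * bool) :=
  rev [seq (p.1, ~~ p.2) | p <- w].

Lemma word_inv_cat w1 w2 : word_inv (w1 ++ w2) = word_inv w2 ++ word_inv w1.
Proof. by rewrite /word_inv map_cat rev_cat. Qed.

Lemma word_eq_inv w1 w2 : word_eq w1 w2 -> word_eq (word_inv w1) (word_inv w2).
Proof.
elim=> {w1 w2} [w|w1 w2 _ h|w1 w2 w3 _ h1 _ h2|w1 w2 w3 w4 _ h1 _ h2|t b].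
- exact: word_eq_refl.
- exact: word_eq_sym.
- exact: word_eq_trans h1 h2.
- by rewrite !word_inv_cat; apply: word_eq_cat.
- by rewrite /word_inv /= /rev /= negbK; apply: word_eq_cancel.
Qed.

Lemma word_invl w : word_eq (word_inv w ++ w) [::].
Proof.
elim: w => [|[t b] w IH]; first exact: word_eq_refl.
rewrite -cat1s word_inv_cat -catA (catA (word_inv [:: _])).
apply: word_eq_trans IH; apply: word_eq_cat; first exact: word_eq_refl.
rewrite -[X in word_eq _ X]cat0s; apply: word_eq_cat; last exact: word_eq_refl.
by have := word_eq_cancel t (~~ b); rewrite negbK.
Qed.

Lemma word_invK : involutive word_inv.
Proof.
move=> w; rewrite /word_inv map_rev revK -map_comp -[RHS]map_id.
by apply: eq_map => -[t b] /=; rewrite negbK.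
Qed.

Definition fg_mul (u v : free_group) : free_group :=
  \pi_free_group (repr u ++ repr v).
Definition fg_one : free_group := \pi_free_group [::].
Definition fg_inv (u : free_group) : free_group := \pi_free_group (word_inv (repr u)).

Lemma fg_mul_pi (w1 w2 : seq (T * bool)) :
  fg_mul (\pi_free_group w1) (\pi_free_group w2) = \pi_free_group (w1 ++ w2).
Proof. by apply/free_group_eqP/word_eq_cat; exact: repr_word. Qed.

Lemma fg_inv_pi (w : seq (T * bool)) : 
  fg_inv (\pi_free_group w) = \pi_free_group (word_inv w).
Proof. by apply/free_group_eqP/word_eq_inv; exact: repr_word. Qed.

Lemma fg_mulA : associative fg_mul.
Proof.
move=> u v w; elim/quotW: u => u; elim/quotW: v => v; elim/quotW: w => w.
  by rewrite (fg_mul_pi v w) (fg_mul_pi u v) !fg_mul_pi catA.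
Qed.
Lemma fg_mul1 : left_id fg_one fg_mul.
Proof. by move=> u; elim/quotW: u => u; rewrite fg_mul_pi. Qed.
Lemma fg_mulr1 : right_id fg_one fg_mul.
Proof. by move=> u; elim/quotW: u => u; rewrite fg_mul_pi cats0. Qed.
Lemma fg_mulV : left_inverse fg_one fg_inv fg_mul.
Proof.
move=> u; elim/quotW: u => u; rewrite fg_inv_pi fg_mul_pi.
exact/free_group_eqP/word_invl.
Qed.
Lemma fg_mulrV : right_inverse fg_one fg_inv fg_mul.
Proof.
move=> u; elim/quotW: u => u; rewrite fg_inv_pi fg_mul_pi; apply/free_group_eqP.
by rewrite -{1}[u]word_invK; exact: word_invl.
Qed.

HB.instance Definition _ := isGroup.Build free_group
  fg_mulA fg_mul1 fg_mulr1 fg_mulV fg_mulrV.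

Definition fgen (t : T) : free_group := \pi_free_group [:: (t, false)].

Lemma fg_ind (P : free_group -> Prop) :
  P 1%g -> (forall t u, P u -> P (fgen t * u)%g) ->
  (forall t u, P u -> P ((fgen t)^-1 * u)%g) -> forall u, P u.
Proof.
move=> P1 Pg Pv; elim/quotW; elim=> [//|[t b] w IH].
rewrite -cat1s -fg_mul_pi; case: b.
  have -> : \pi_free_group [:: (t, true)] = (fgen t)^-1%g.
    by rewrite /fgen [RHS]fg_inv_pi.
  exact: Pv.
exact: Pg.
Qed.

Section Extension.
Variables (G : groupType) (f : T -> G).

Definition word_eval (w : seq (T * bool)) : G :=
  foldr (fun p a => ((if p.2 then (f p.1)^-1 else f p.1) * a)%g) 1%g w.

Lemma word_eval_cat w1 w2 :
  word_eval (w1 ++ w2) = (word_eval w1 * word_eval w2)%g.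
Proof.
by elim: w1 => [|p w1 IH] /=; rewrite ?mul1g // IH mulgA.
Qed.

Lemma word_eval_eq w1 w2 : word_eq w1 w2 -> word_eval w1 = word_eval w2.
Proof.
elim=> {w1 w2} [//|//|w1 w2 w3 _ -> _ -> //|w1 w2 w3 w4 _ h1 _ h2|t b].
  by rewrite !word_eval_cat h1 h2.
by case: b; rewrite /= mulg1 ?mulVg ?mulgV.
Qed.

(** The homomorphism sending each generator [t] to [f t]. *)
Definition fg_ext (u : free_group) : G := word_eval (repr u).

Lemma fg_ext_pi (w : seq (T * bool)) : fg_ext (\pi_free_group w) = word_eval w.
Proof. exact/word_eval_eq/repr_word. Qed.

Lemma fg_extM : {morph fg_ext : u v / (u * v)%g}.
Proof.
move=> u v; elim/quotW: u => u; elim/quotW: v => v; rewrite [(_ * _)%g]fg_mul_pi !fg_ext_pi.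
exact: word_eval_cat.
Qed.

HB.instance Definition _ := isMultiplicative.Build free_group G fg_ext fg_extM.

Lemma fg_ext_gen t : fg_ext (fgen t) = f t.
Proof. by rewrite fg_ext_pi /= mulg1. Qed.

Lemma fg_ext1 : fg_ext 1%g = 1%g.
Proof. exact: fg_ext_pi. Qed.

Lemma fg_extV u : fg_ext u^-1%g = (fg_ext u)^-1%g.
Proof. by apply: (mulgI (fg_ext u)); rewrite -fg_extM !mulgV fg_ext1. Qed.
End Extension.
End FreeGroup.

Arguments fgen {T} t.

Section LowerCentralSeries.
Variable G : groupType.

Inductive generated (S : G -> Prop) : G -> Prop :=
| generated_mem a : S a -> generated S a
| generated_one : generated S 1%g
| generated_mul a b : generated S a -> generated S b -> generated S (a * b)%g
| generated_inv a : generated S a -> generated S a^-1%g.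

Fixpoint lcs_rec (n : nat) : G -> Prop :=
  if n is m.+1 then
    generated (fun c => exists2 a, lcs_rec m a & exists b, c = commg a b)
  else fun=> True.

(** [lcs q] is $G_q$, with $G_1 = G$; by convention also $G_0 = G$. *)
Definition lcs (q : nat) : G -> Prop := lcs_rec q.-1.

Definition eq_mod_lcs (q : nat) (a b : G) : Prop := lcs q (a^-1 * b)%g.
End LowerCentralSeries.

Section FreeAbelian.
Variable T : finType.

Definition free_ab := {ffun T -> int}.
HB.instance Definition _ := GRing.Zmodule.on free_ab.

Definition ab_gen (t : T) : free_ab := [ffun s => (s == t)%:R].

Definition word_ab (w : seq (T * bool)) : free_ab :=
  \sum_(p <- w) (if p.2 then - ab_gen p.1 else ab_gen p.1).

(** The exponent sums of [u]; [ab_classP] and [ab_class_surj] below say that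
    this is the projection of the free group onto its abelianization. *)
Definition ab_class (u : free_group T) : free_ab := word_ab (repr u).

Lemma word_ab_eq w1 w2 : word_eq w1 w2 -> word_ab w1 = word_ab w2.
Proof.
elim=> {w1 w2} [//|//|w1 w2 w3 _ -> _ -> //|w1 w2 w3 w4 _ h1 _ h2|t b].
  by rewrite /word_ab !big_cat -!/(word_ab _) h1 h2.
by rewrite /word_ab !big_cons !big_nil; case: b; rewrite /= addr0 ?subrr ?addNr.
Qed.

Lemma ab_class_pi (w : seq (T * bool)) : ab_class (\pi_(free_group T) w) = word_ab w.
Proof. exact/word_ab_eq/repr_word. Qed.

Lemma ab_classM u v : ab_class (u * v)%g = ab_class u + ab_class v.
Proof.
elim/quotW: u => u; elim/quotW: v => v.
by rewrite [(_ * _)%g]fg_mul_pi !ab_class_pi /word_ab big_cat.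
Qed.

Lemma ab_class1 : ab_class 1%g = 0.
Proof. by rewrite ab_class_pi /word_ab big_nil. Qed.

Lemma ab_classV u : ab_class u^-1%g = - ab_class u.
Proof. by apply/eqP; rewrite -addr_eq0 -ab_classM mulVg ab_class1. Qed.

Lemma ab_class_gen t : ab_class (fgen t) = ab_gen t.
Proof. by rewrite ab_class_pi /word_ab big_seq1. Qed.


Lemma ab_class_eq1 u : lcs 2 u -> ab_class u = 0.
Proof.
rewrite /lcs /=; elim=> {u} [c [a _ [b ->]]||a b _ ha _ hb|a _ ha].
- by rewrite !ab_classM !ab_classV addrA -opprD addNr.
- exact: ab_class1.
- by rewrite ab_classM ha hb addr0.
- by rewrite ab_classV ha oppr0.
Qed.


Let expz (t : T) (z : int) : free_group T :=
  match z with Posz n => (fgen t ^+ n)%g | Negz n => (fgen t ^- n.+1)%g end.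

Let normal_word (s : seq T) (v : free_ab) : free_group T :=
  foldr (fun t a => (expz t (v t) * a)%g) 1%g s.

Let expzS t z : (fgen t * expz t z)%g = expz t (z + 1).
Proof.
case: z => [n|n].
  by have -> : Posz n + 1 = Posz n.+1 by [rewrite -addn1 PoszD]; rewrite /= expgS.
case: n => [|n]; first by rewrite /= expg1 mulgV.
have -> : Negz n.+1 + 1 = Negz n by rewrite !NegzE -addn1 PoszD opprD addrNK.
by rewrite /= [in LHS]expgSr invgM mulgA mulgV mul1g.
Qed.

Let ab_expz t z : ab_class (expz t z) = ab_gen t *~ z.
Proof.
have abX n : ab_class (fgen t ^+ n)%g = ab_gen t *+ n.
  elim: n => [|n IH]; first by rewrite expg0 ab_class1.
  by rewrite expgS ab_classM IH ab_class_gen mulrS.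
by case: z => n; rewrite /= ?ab_classV abX.
Qed.

Let ab_normal_word s v x : uniq s ->
  ab_class (normal_word s v) x = if x \in s then v x else 0.
Proof.
elim: s => [_|t s IH /= /andP[ts us]]; first by rewrite ab_class1 ffunE.
rewrite ab_classM ffunE IH // ab_expz inE.
have -> : (ab_gen t *~ v t) x = (x == t)%:R *~ v t.
  by case: (v t) => n; rewrite /intmul ?ffunE ?ffunMnE /ab_gen ffunE.
case: eqP => [->|_]; first by rewrite (negPf ts) addr0 intz.
by rewrite mul0rz add0r.
Qed.

Lemma ab_class_surj v : exists u, ab_class u = v.
Proof.
exists (normal_word (enum T) v); apply/ffunP => x.
by rewrite ab_normal_word ?enum_uniq // mem_enum.
Qed.

Let eqm := @eq_mod_lcs (free_group T) 2.

Let eqm_sym a b : eqm a b -> eqm b a.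
Proof. by move=> /generated_inv; rewrite invgM invgK. Qed.
Let eqm_trans b a c : eqm a b -> eqm b c -> eqm a c.
Proof.
by move=> h1 h2; have := generated_mul h1 h2; rewrite mulgA mulgK.
Qed.
Let eqm_mull a b c : eqm a b -> eqm (c * a)%g (c * b)%g.
Proof. by rewrite /eqm /eq_mod_lcs invgM -!mulgA mulKg. Qed.
Let eqm_comm a b c : eqm (a * (b * c))%g (b * (a * c))%g.
Proof.
have comm x y : lcs 2 (commg x y : free_group T).
  by apply: generated_mem; exists x => //; exists y.
rewrite /eqm /eq_mod_lcs.
have -> : ((a * (b * c))^-1 * (b * (a * c)) =
  commg b a * commg (commg b a) c)%g.
  by rewrite [commg (commg b a) c]commgEl mulVKg /commg /conjg !invgM !mulgA.
exact: generated_mul (comm b a) (comm (commg b a) c).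
Qed.

Let gen_normal_word t s v : uniq s -> t \in s ->
  eqm (fgen t * normal_word s v)%g (normal_word s (v + ab_gen t)).
Proof.
elim: s => [//|r s IH /= /andP[rs us]].
rewrite inE; have [-> _|tr /= ts] := eqVneq t r.
  rewrite mulgA expzS !ffunE eqxx.
  have -> : normal_word s (v + ab_gen r) = normal_word s v.
    elim: s rs {us IH} => //= a s IH; rewrite inE negb_or => /andP[ra rs].
    by rewrite IH // !ffunE eq_sym (negPf ra) addr0.
  by rewrite /eqm /eq_mod_lcs mulVg; apply: generated_one.
rewrite !ffunE eq_sym (negPf tr) addr0.
apply: eqm_trans (eqm_comm _ _ _) _.
exact/eqm_mull/IH.
Qed.

Let eqm_normal_word u : eqm u (normal_word (enum T) (ab_class u)).
Proof.
have gen := @gen_normal_word _ _ _ (enum_uniq T) (mem_enum T _).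
elim/(@fg_ind T): u => [|t u IH|t u IH].
- rewrite ab_class1.
  have -> : normal_word (enum T) 0 = 1%g.
    by elim: (enum T) => //= t s ->; rewrite ffunE mul1g.
  by rewrite /eqm /eq_mod_lcs mulVg; apply: generated_one.
- rewrite ab_classM ab_class_gen addrC.
  exact: eqm_trans (eqm_mull _ IH) (gen _ _).
- rewrite ab_classM ab_classV ab_class_gen addrC.
  apply: eqm_trans (eqm_mull _ IH) _; apply: eqm_sym.
  set v := ab_class u.
  have := eqm_mull (fgen t)^-1%g (gen t (v - ab_gen t)).
  by rewrite subrK mulKg.
Qed.

Lemma ab_classP u v : ab_class u = ab_class v <-> eq_mod_lcs 2 u v.
Proof.
split=> [uv|/ab_class_eq1].
  apply: eqm_trans (eqm_normal_word u) _; rewrite uv.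
  exact/eqm_sym/eqm_normal_word.
by rewrite ab_classM ab_classV addrC => /eqP; rewrite subr_eq0 => /eqP.
Qed.
End FreeAbelian.

Inductive lie_term (V : Type) : Type :=
| LieGen of V
| LieZero
| LieAdd of lie_term V & lie_term V
| LieOpp of lie_term V
| LieBr of lie_term V & lie_term V.

Arguments LieZero {V}.

Inductive lie_eq (V : zmodType) : lie_term V -> lie_term V -> Prop :=
| lie_eq_refl a : lie_eq a a
| lie_eq_sym a b : lie_eq a b -> lie_eq b a
| lie_eq_trans a b c : lie_eq a b -> lie_eq b c -> lie_eq a c
| lie_eq_add a a' b b' :
    lie_eq a a' -> lie_eq b b' -> lie_eq (LieAdd a b) (LieAdd a' b')
| lie_eq_opp a a' : lie_eq a a' -> lie_eq (LieOpp a) (LieOpp a')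
| lie_eq_br a a' b b' :
    lie_eq a a' -> lie_eq b b' -> lie_eq (LieBr a b) (LieBr a' b')
| lie_eq_addA a b c :
    lie_eq (LieAdd a (LieAdd b c)) (LieAdd (LieAdd a b) c)
| lie_eq_addC a b : lie_eq (LieAdd a b) (LieAdd b a)
| lie_eq_add0 a : lie_eq (LieAdd LieZero a) a
| lie_eq_addN a : lie_eq (LieAdd (LieOpp a) a) LieZero
| lie_eq_gen u v : lie_eq (LieGen (u + v)) (LieAdd (LieGen u) (LieGen v))
| lie_eq_brDl a b c :
    lie_eq (LieBr (LieAdd a b) c) (LieAdd (LieBr a c) (LieBr b c))
| lie_eq_brDr a b c :
    lie_eq (LieBr a (LieAdd b c)) (LieAdd (LieBr a b) (LieBr a c))
| lie_eq_alt a : lie_eq (LieBr a a) LieZero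
| lie_eq_jacobi a b c :
    lie_eq (LieAdd (LieBr a (LieBr b c))
             (LieAdd (LieBr b (LieBr c a)) (LieBr c (LieBr a b)))) LieZero.

HB.instance Definition _ (V : Type) := gen_eqMixin (lie_term V).
HB.instance Definition _ (V : Type) := gen_choiceMixin (lie_term V).

Section FreeLie.
Variable V : zmodType.

Definition lie_eqb (a b : lie_term V) : bool := `[< lie_eq a b >].

Lemma lie_eqb_refl : reflexive lie_eqb.
Proof. by move=> a; apply/asboolP; exact: lie_eq_refl. Qed.
Lemma lie_eqb_sym : symmetric lie_eqb.
Proof. by move=> a b; apply/asboolP/asboolP; exact: lie_eq_sym. Qed.
Lemma lie_eqb_trans : transitive lie_eqb.
Proof.
move=> b a c /asboolP h1 /asboolP h2; apply/asboolP.
exact: lie_eq_trans h1 h2.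
Qed.

Canonical lie_equiv := EquivRel lie_eqb lie_eqb_refl lie_eqb_sym lie_eqb_trans.

Definition free_lie := {eq_quot lie_equiv}.
HB.instance Definition _ := EqQuotient.on free_lie.
HB.instance Definition _ := Choice.on free_lie.

Lemma free_lie_eqP (a b : lie_term V) :
  \pi_free_lie a = \pi_free_lie b <-> lie_eq a b.
Proof.
split; first by move/eqmodP => /asboolP.
by move=> h; apply/eqmodP/asboolP.
Qed.

Lemma repr_lie (a : lie_term V) : lie_eq (repr (\pi_free_lie a)) a.
Proof. by apply/free_lie_eqP; rewrite reprK. Qed.

Definition fl_add (x y : free_lie) : free_lie :=
  \pi_free_lie (LieAdd (repr x) (repr y)).
Definition fl_zero : free_lie := \pi_free_lie LieZero.
Definition fl_opp (x : free_lie) : free_lie := \pi_free_lie (LieOpp (repr x)).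

Definition lie_br (x y : free_lie) : free_lie :=
  \pi_free_lie (LieBr (repr x) (repr y)).
Definition lie_gen (v : V) : free_lie := \pi_free_lie (LieGen v).

Lemma fl_add_pi (a b : lie_term V) :
  fl_add (\pi_free_lie a) (\pi_free_lie b) = \pi_free_lie (LieAdd a b).
Proof. by apply/free_lie_eqP/lie_eq_add; exact: repr_lie. Qed.

Lemma fl_opp_pi (a : lie_term V) :
  fl_opp (\pi_free_lie a) = \pi_free_lie (LieOpp a).
Proof. by apply/free_lie_eqP/lie_eq_opp; exact: repr_lie. Qed.

Lemma lie_br_pi (a b : lie_term V) :
  lie_br (\pi_free_lie a) (\pi_free_lie b) = \pi_free_lie (LieBr a b).
Proof. by apply/free_lie_eqP/lie_eq_br; exact: repr_lie. Qed.

Lemma fl_addA : associative fl_add.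
Proof.
move=> x y z; elim/quotW: x => x; elim/quotW: y => y; elim/quotW: z => z.
rewrite (fl_add_pi y z) (fl_add_pi x y) (fl_add_pi x (LieAdd y z)).
rewrite (fl_add_pi (LieAdd x y) z); apply/free_lie_eqP; exact: lie_eq_addA.
Qed.
Lemma fl_addC : commutative fl_add.
Proof.
move=> x y; elim/quotW: x => x; elim/quotW: y => y.
by rewrite !fl_add_pi; apply/free_lie_eqP; exact: lie_eq_addC.
Qed.
Lemma fl_add0 : left_id fl_zero fl_add.
Proof.
move=> x; elim/quotW: x => x.
by rewrite (fl_add_pi LieZero x); apply/free_lie_eqP; exact: lie_eq_add0.
Qed.
Lemma fl_addN : left_inverse fl_zero fl_opp fl_add.
Proof.
move=> x; elim/quotW: x => x; rewrite (fl_opp_pi x) (fl_add_pi (LieOpp x) x).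
by apply/free_lie_eqP; exact: lie_eq_addN.
Qed.

HB.instance Definition _ := GRing.isZmodule.Build free_lie
  fl_addA fl_addC fl_add0 fl_addN.

Lemma lie_genD u v : lie_gen (u + v) = lie_gen u + lie_gen v.
Proof. by rewrite [RHS]fl_add_pi; apply/free_lie_eqP; exact: lie_eq_gen. Qed.

Lemma lie_brDl x y z : lie_br (x + y) z = lie_br x z + lie_br y z.
Proof.
elim/quotW: x => x; elim/quotW: y => y; elim/quotW: z => z.
rewrite [\pi_free_lie x + _](fl_add_pi x y) (lie_br_pi (LieAdd x y) z).
rewrite (lie_br_pi x z) (lie_br_pi y z) [RHS](fl_add_pi (LieBr x z)).
by apply/free_lie_eqP; exact: lie_eq_brDl.
Qed.

Lemma lie_brDr x y z : lie_br x (y + z) = lie_br x y + lie_br x z.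
Proof.
elim/quotW: x => x; elim/quotW: y => y; elim/quotW: z => z.
rewrite [\pi_free_lie y + _](fl_add_pi y z) (lie_br_pi x (LieAdd y z)).
rewrite (lie_br_pi x y) (lie_br_pi x z) [RHS](fl_add_pi (LieBr x y)).
by apply/free_lie_eqP; exact: lie_eq_brDr.
Qed.

Lemma lie_brxx x : lie_br x x = 0.
Proof.
elim/quotW: x => x; rewrite (lie_br_pi x x).
by apply/free_lie_eqP; exact: lie_eq_alt.
Qed.

Lemma lie_jacobi x y z :
  lie_br x (lie_br y z) + (lie_br y (lie_br z x) + lie_br z (lie_br x y)) = 0.
Proof.
elim/quotW: x => x; elim/quotW: y => y; elim/quotW: z => z.
rewrite (lie_br_pi x y) (lie_br_pi y z) (lie_br_pi z x).
rewrite (lie_br_pi x (LieBr y z)) (lie_br_pi y (LieBr z x)).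
rewrite (lie_br_pi z (LieBr x y)).
rewrite [X in _ + X](fl_add_pi (LieBr y _) (LieBr z _)).
rewrite [LHS](fl_add_pi (LieBr x _)).
by apply/free_lie_eqP; exact: lie_eq_jacobi.
Qed.

Inductive lie_homog : nat -> free_lie -> Prop :=
| lie_homog_gen v : lie_homog 1 (lie_gen v)
| lie_homog_zero q : lie_homog q 0
| lie_homog_sub q x y : lie_homog q x -> lie_homog q y -> lie_homog q (x - y)
| lie_homog_br p q x y :
    lie_homog p x -> lie_homog q y -> lie_homog (p + q) (lie_br x y).

Definition lie_part_pred (q : nat) : {pred free_lie} :=
  fun x => `[< lie_homog q x >].

Lemma lie_part_pred_zmod q : zmod_closed (lie_part_pred q).
Proof.
split; first by apply/asboolP; exact: lie_homog_zero.
by move=> x y /asboolP hx /asboolP hy; apply/asboolP; exact: lie_homog_sub.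
Qed.

HB.instance Definition _ (q : nat) :=
  GRing.isZmodClosed.Build free_lie (lie_part_pred q) (lie_part_pred_zmod q).

Record lie_part (q : nat) :=
  LiePart { lie_part_val :> free_lie; _ : lie_part_val \in lie_part_pred q }.

HB.instance Definition _ (q : nat) := [isSub for @lie_part_val q].
HB.instance Definition _ (q : nat) := [Choice of lie_part q by <:].
HB.instance Definition _ (q : nat) :=
  [SubChoice_isSubZmodule of lie_part q by <:].
End FreeLie.

Inductive tensor_term (A B : Type) : Type :=
| TenPure of A & B
| TenZero
| TenAdd of tensor_term A B & tensor_term A B
| TenOpp of tensor_term A B.

Arguments TenZero {A B}.

Inductive tensor_eq (A B : zmodType) :
  tensor_term A B -> tensor_term A B -> Prop :=
| tensor_eq_refl s : tensor_eq s s
| tensor_eq_sym s t : tensor_eq s t -> tensor_eq t s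
| tensor_eq_trans s t u : tensor_eq s t -> tensor_eq t u -> tensor_eq s u
| tensor_eq_add s s' t t' :
    tensor_eq s s' -> tensor_eq t t' -> tensor_eq (TenAdd s t) (TenAdd s' t')
| tensor_eq_opp s s' : tensor_eq s s' -> tensor_eq (TenOpp s) (TenOpp s')
| tensor_eq_addA s t u :
    tensor_eq (TenAdd s (TenAdd t u)) (TenAdd (TenAdd s t) u)
| tensor_eq_addC s t : tensor_eq (TenAdd s t) (TenAdd t s)
| tensor_eq_add0 s : tensor_eq (TenAdd TenZero s) s
| tensor_eq_addN s : tensor_eq (TenAdd (TenOpp s) s) TenZero
| tensor_eq_pureDl a a' b :
    tensor_eq (TenPure (a + a') b) (TenAdd (TenPure a b) (TenPure a' b))
| tensor_eq_pureDr a b b' :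
    tensor_eq (TenPure a (b + b')) (TenAdd (TenPure a b) (TenPure a b')).

HB.instance Definition _ (A B : Type) := gen_eqMixin (tensor_term A B).
HB.instance Definition _ (A B : Type) := gen_choiceMixin (tensor_term A B).

Section Tensor.
Variables A B : zmodType.

Definition tensor_eqb (s t : tensor_term A B) : bool := `[< tensor_eq s t >].

Lemma tensor_eqb_refl : reflexive tensor_eqb.
Proof. by move=> s; apply/asboolP; exact: tensor_eq_refl. Qed.
Lemma tensor_eqb_sym : symmetric tensor_eqb.
Proof. by move=> s t; apply/asboolP/asboolP; exact: tensor_eq_sym. Qed.
Lemma tensor_eqb_trans : transitive tensor_eqb.
Proof.
move=> t s u /asboolP h1 /asboolP h2; apply/asboolP.
exact: tensor_eq_trans h1 h2.
Qed.

Canonical tensor_equiv := EquivRel tensor_eqb tensor_eqb_refl tensor_eqb_sym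
  tensor_eqb_trans.

Definition tensor := {eq_quot tensor_equiv}.
HB.instance Definition _ := EqQuotient.on tensor.
HB.instance Definition _ := Choice.on tensor.

Lemma tensor_eqP (s t : tensor_term A B) :
  \pi_tensor s = \pi_tensor t <-> tensor_eq s t.
Proof.
split; first by move/eqmodP => /asboolP.
by move=> h; apply/eqmodP/asboolP.
Qed.

Lemma repr_tensor (s : tensor_term A B) : tensor_eq (repr (\pi_tensor s)) s.
Proof. by apply/tensor_eqP; rewrite reprK. Qed.

Definition ten_add (x y : tensor) : tensor :=
  \pi_tensor (TenAdd (repr x) (repr y)).
Definition ten_zero : tensor := \pi_tensor TenZero.
Definition ten_opp (x : tensor) : tensor := \pi_tensor (TenOpp (repr x)).

Definition pure (a : A) (b : B) : tensor := \pi_tensor (TenPure a b).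

Lemma ten_add_pi (s t : tensor_term A B) :
  ten_add (\pi_tensor s) (\pi_tensor t) = \pi_tensor (TenAdd s t).
Proof. by apply/tensor_eqP/tensor_eq_add; exact: repr_tensor. Qed.

Lemma ten_opp_pi (s : tensor_term A B) :
  ten_opp (\pi_tensor s) = \pi_tensor (TenOpp s).
Proof. by apply/tensor_eqP/tensor_eq_opp; exact: repr_tensor. Qed.

Lemma ten_addA : associative ten_add.
Proof.
move=> x y z; elim/quotW: x => x; elim/quotW: y => y; elim/quotW: z => z.
rewrite (ten_add_pi y z) (ten_add_pi x y) (ten_add_pi x (TenAdd y z)).
rewrite (ten_add_pi (TenAdd x y) z); apply/tensor_eqP; exact: tensor_eq_addA.
Qed.
Lemma ten_addC : commutative ten_add.
Proof.
move=> x y; elim/quotW: x => x; elim/quotW: y => y.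
by rewrite !ten_add_pi; apply/tensor_eqP; exact: tensor_eq_addC.
Qed.
Lemma ten_add0 : left_id ten_zero ten_add.
Proof.
move=> x; elim/quotW: x => x.
by rewrite (ten_add_pi TenZero x); apply/tensor_eqP; exact: tensor_eq_add0.
Qed.
Lemma ten_addN : left_inverse ten_zero ten_opp ten_add.
Proof.
move=> x; elim/quotW: x => x; rewrite (ten_opp_pi x) (ten_add_pi (TenOpp x) x).
by apply/tensor_eqP; exact: tensor_eq_addN.
Qed.

HB.instance Definition _ := GRing.isZmodule.Build tensor
  ten_addA ten_addC ten_add0 ten_addN.

Lemma pureDl a a' b : pure (a + a') b = pure a b + pure a' b.
Proof. by rewrite [RHS]ten_add_pi; apply/tensor_eqP; exact: tensor_eq_pureDl. Qed.

Lemma pureDr a b b' : pure a (b + b') = pure a b + pure a b'.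
Proof. by rewrite [RHS]ten_add_pi; apply/tensor_eqP; exact: tensor_eq_pureDr. Qed.

Section Lift.
Variables (C : zmodType) (f : A -> B -> C).

Fixpoint tensor_eval (s : tensor_term A B) : C :=
  match s with
  | TenPure a b => f a b
  | TenZero => 0
  | TenAdd s t => tensor_eval s + tensor_eval t
  | TenOpp s => - tensor_eval s
  end.

(** For biadditive [f] this is the homomorphism sending [pure a b] to
    [f a b]. *)
Definition tensor_lift (x : tensor) : C := tensor_eval (repr x).

Hypothesis fDl : forall a a' b, f (a + a') b = f a b + f a' b.
Hypothesis fDr : forall a b b', f a (b + b') = f a b + f a b'.

Lemma tensor_eval_eq s t : tensor_eq s t -> tensor_eval s = tensor_eval t.
Proof.
by elim=> {s t} //=; try (by move=> *; congruence);
  do ?[by move=> *; rewrite ?addrA ?add0r ?addNr ?fDl ?fDr // addrC].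
Qed.

Lemma tensor_lift_pi (s : tensor_term A B) :
  tensor_lift (\pi_tensor s) = tensor_eval s.
Proof. exact/tensor_eval_eq/repr_tensor. Qed.

Lemma tensor_lift_pure a b : tensor_lift (pure a b) = f a b.
Proof. exact: tensor_lift_pi. Qed.

Lemma tensor_liftB x y :
  tensor_lift (x - y) = tensor_lift x - tensor_lift y.
Proof.
elim/quotW: x => x; elim/quotW: y => y.
rewrite [- \pi_tensor y](ten_opp_pi y).
rewrite [_ + _ in LHS](ten_add_pi x (TenOpp y)).
by rewrite !tensor_lift_pi.
Qed.
End Lift.
End Tensor.

Section DGroup.
Variables (V : zmodType) (k : nat).

(** The bracket map lands in degree [k + 2]; the whole free Lie algebra is
    taken as codomain, which does not change the kernel. *)
Definition bracket_map (x : tensor V (lie_part V k.+1)) : free_lie V :=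
  tensor_lift (fun v (l : lie_part V k.+1) => lie_br (lie_gen v) l) x.

Lemma bracket_mapB : {morph bracket_map : x y / x - y}.
Proof.
by apply: tensor_liftB => *; rewrite ?lie_genD ?lie_brDl ?raddfD ?lie_brDr.
Qed.

Definition D_pred : {pred tensor V (lie_part V k.+1)} :=
  fun x => bracket_map x == 0.

Lemma D_pred_zmod : zmod_closed D_pred.
Proof.
have b0 : bracket_map 0 = 0.
  by rewrite -(subrr (0 : tensor V (lie_part V k.+1))) bracket_mapB subrr.
split; first exact/eqP.
by move=> x y /eqP hx /eqP hy; apply/eqP; rewrite bracket_mapB hx hy subrr.
Qed.

HB.instance Definition _ :=
  GRing.isZmodClosed.Build (tensor V (lie_part V k.+1)) D_pred D_pred_zmod.

Record D_group := DGroup {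
  D_val :> tensor V (lie_part V k.+1);
  _ : D_val \in D_pred
}.

HB.instance Definition _ := [isSub for D_val].
HB.instance Definition _ := [Choice of D_group by <:].
HB.instance Definition _ := [SubChoice_isSubZmodule of D_group by <:].
End DGroup.

(** [gr_class q a u] is the graph of the canonical isomorphism between the
    degree [q] part of the free Lie algebra on the abelianization of a free
    group [F] and $F_q / F_{q+1}$: it says that [a] corresponds to the class
    of [u]. The isomorphism is the identity in degree one and takes Lie
    brackets to classes of commutators, and this determines it. *)
Inductive gr_class (T : finType) :
  nat -> free_lie (free_ab T) -> free_group T -> Prop :=
| gr_class_gen u : gr_class 1 (lie_gen (ab_class u)) u
| gr_class_zero q : gr_class q 0 1%g
| gr_class_sub q a b u v :
    gr_class q a u -> gr_class q b v -> gr_class q (a - b) (u * v^-1)%g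
| gr_class_br p q a b u v :
    gr_class p a u -> gr_class q b v ->
    gr_class (p + q) (lie_br a b) (commg u v)
| gr_class_mod q a u v :
    gr_class q a u -> eq_mod_lcs q.+1 u v -> gr_class q a v.

Section Lagrangian.
Variable g : nat.

Definition surface_group := free_group ('I_g + 'I_g)%type.
Definition handlebody_group := free_group 'I_g.

Definition xg (j : 'I_g) : surface_group := fgen (inl j).
Definition yg (j : 'I_g) : surface_group := fgen (inr j).

(** Here [commg a b] is $a^{-1}b^{-1}ab$. The convention $aba^{-1}b^{-1}$ is
    exchanged with this one by the automorphism inverting all generators, and
    gives the same image of $J^L_k$. *)
Definition boundary_word : surface_group :=
  (\prod_(j < g) commg (xg j) (yg j))%g.

(** The Dehn-Nielsen-Baer description of the mapping class group of the
    surface of genus [g] with one boundary component. *)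
Record mapping_class := MappingClass {
  mc_fun :> surface_group -> surface_group;
  mc_mul : {morph mc_fun : u v / (u * v)%g};
  mc_bij : bijective mc_fun;
  mc_boundary : mc_fun boundary_word = boundary_word
}.

(** The curves [xg j] bound in the handlebody. *)
Definition i_star : surface_group -> handlebody_group :=
  fg_ext (fun s : 'I_g + 'I_g =>
    match s with inl _ => 1%g | inr j => fgen j : handlebody_group end).

Definition in_FL (k : nat) (h : mapping_class) : Prop :=
  forall j : 'I_g, lcs k.+1 (i_star (h (xg j))) /\
                   eq_mod_lcs 2 (h (xg j)) (xg j).

Definition H_surface := free_ab ('I_g + 'I_g)%type.
Definition H_handlebody := free_ab 'I_g.

Definition H_proj (a : H_surface) : H_handlebody := [ffun j => a (inr j)].

Lemma H_proj_class u : H_proj (ab_class u) = ab_class (i_star u).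
Proof.
have gen (s : 'I_g + 'I_g) :
    H_proj (ab_class (fgen s)) = ab_class (i_star (fgen s)).
  rewrite /i_star fg_ext_gen ab_class_gen; apply/ffunP => j.
  by case: s => s; rewrite ?ab_class1 ?ab_class_gen !ffunE.
have projD (a b : H_surface) : H_proj (a + b) = H_proj a + H_proj b.
  by apply/ffunP => j; rewrite !ffunE.
have projN (a : H_surface) : H_proj (- a) = - H_proj a.
  by apply/ffunP => j; rewrite !ffunE.
elim/(@fg_ind ('I_g + 'I_g)%type): u => [|s u IH|s u IH].
- by rewrite /i_star fg_ext1 !ab_class1; apply/ffunP => j; rewrite !ffunE.
- by rewrite /i_star fg_extM !ab_classM projD IH gen.
- by rewrite /i_star fg_extM fg_extV !ab_classM !ab_classV projD projN IH gen.
Qed.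

Definition in_L (l : H_surface) : Prop := H_proj l = 0.

(** The opposite sign convention would replace $J^L_k$ by its negative. *)
Definition omega (a b : H_surface) : int :=
  \sum_(j < g) (a (inl j) * b (inr j) - a (inr j) * b (inl j)).

Definition H_lift (v : H_handlebody) : H_surface :=
  [ffun s => match s with inl _ => 0 | inr j => v j end].

Lemma omega_lift (l a : H_surface) :
  in_L l -> omega l (H_lift (H_proj a)) = omega l a.
Proof.
move=> /ffunP hl; apply: eq_bigr => j _; rewrite !ffunE.
by have := hl j; rewrite !ffunE => ->; rewrite !mul0r.
Qed.

(** The isomorphism from $H' \otimes M$ to $\mathrm{Hom}(L, M)$ induced by
    the symplectic form through the duality between $L$ and $H/L = H'$. *)
Definition duality (M : zmodType) (t : tensor H_handlebody M)
    (l : H_surface) : M :=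
  tensor_lift (fun v m => m *~ omega l (H_lift v)) t.

(** The graph of $J^L_k$: [is_JL h d] says that [h] is in the [k]-th term of
    the Lagrangian filtration and $J^L_k(h) = d$. For each [l] the kernel of
    [i_star] contains representatives [lambda] of [l], and the class of
    $i_*h_*(\lambda)$ depends only on [l]. *)
Definition is_JL (k : nat) (h : mapping_class) (d : D_group H_handlebody k) :
    Prop :=
  in_FL k h /\
  forall l : H_surface, in_L l ->
  forall lambda : surface_group, i_star lambda = 1%g -> ab_class lambda = l ->
  gr_class k.+1 (duality (D_val d) l) (i_star (h lambda)).

Definition JL_image (k : nat) (d : D_group H_handlebody k) : Prop :=
  exists h : mapping_class, is_JL h d.
End Lagrangian.

Section Index.
Variables (A : zmodType) (S : A -> Prop).

Definition is_subgroup : Prop := S 0 /\ forall a b, S a -> S b -> S (a - b).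

Definition has_index (n : nat) : Prop :=
  exists r : 'I_n -> A, forall a, exists! i, S (a - r i).
End Index.

(* Main.v *)
Require Import Defs.
From mathcomp Require Import all_boot all_order all_algebra.
From mathcomp Require Import perm zify ring boolp.
From HB Require Import structures.

(** A trivalent tree with $k+2$ leaves labelled in $V = H'_g$ gives an element
    of $\mathsf D_k(V)$, the sum over its leaves $v$ of $v\otimes T_v$, where
    $T_v$ is the Lie element of the tree rooted at $v$. The proof shows that
    these elements nearly generate $\mathsf D_k(V)$ and that all of them are in
    the image of $J^L_k$.

    Generators. For Lie elements $A$ and $B$ let [cut A B] be the part of this
    sum that belongs to the leaves of $A$, for the tree that joins the roots of
    $A$ and $B$ by an edge, so that [tree A B = cut A B + cut B A]. The Jacobi
    identity gives that the bracket of [cut A B] is $[A,B]$. Conversely the rule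
    $[A,B]\mapsto{}$[cut A B] turns a bracket into a preimage in
    $V\otimes\mathsf L_{k+1}(V)$. It sends the antisymmetry and Jacobi relations
    to trees and the relation $[A,A]=0$ to [cut A A], so the kernel of the
    bracket is generated by trees and by the elements [cut A A] ([D_span]).
    As [tree A A] is twice [cut A A], the trees generate a subgroup that
    contains $2\mathsf D_k(V)$. If $k$ is odd then $A$ and $A$ cannot have total
    degree $k+2$, and the trees generate everything ([D_generated]).

    Realization. A tree with labels in $H_g$ becomes a derivation of
    $\mathsf L(H_g)$ when the leaves are contracted by the intersection form
    ([tree_der]). If this derivation is the Johnson homomorphism of a mapping
    class, then $J^L_k$ of this class is the projection of the tree to $V$
    ([johnson_JL]). Tripods come from pushing one handle around the longitude of
    another ([realized_push]). Dehn twists and permutations of the handles move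
    their leaves ([realized_yyy], [realized_yyx]). A commutator of mapping
    classes realizes the commutator of the derivations ([realized_comm]), and
    for a tripod with leaves $y_a$, $y_b$, $x_c$ and a tree with a single leaf
    $y_c$ this commutator is the tree glued together along $x_c$ and $y_c$
    ([realized_glue]). Since right-normed brackets span the free Lie algebra, it
    is enough to realize trees of the form $y_a$ joined to a right-normed
    bracket in the $y_j$. Such a tree is glued from a tripod and a smaller tree
    of the same form with $k$ labels besides the root, and $g>k$ leaves an index
    $c$ for the root that is not among them ([realized_rnorm]).

    Subgroup and index. A mapping class in the Lagrangian filtration acts
    trivially on $H'_g$ ([in_FL_homology]), so $J^L_k$ is additive
    ([is_JL_comp]). Its image contains all doubles, and $\mathsf D_k(V)$ is
    generated by the image and finitely many elements [cut A A]. Adjoining these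
    one at a time multiplies the index by one or two each time
    ([index_power_of_2]). *)

Set Implicit Arguments.
Unset Strict Implicit.
Unset Printing Implicit Defensive.

Import GRing.Theory.
Local Open Scope quotient_scope.
Local Open Scope ring_scope.

(** * The lower central series *)

Section LowerCentralSeriesTheory.
Variable G : groupType.
Local Open Scope group_scope.
Implicit Types (u v w x y z : G) (m n p q : nat).

Lemma generatedJ (S : G -> Prop) z : (forall x, S x -> S (x ^ z)) ->
  forall x, generated S x -> generated S (x ^ z).
Proof.
move=> SJ x; elim=> {x} [x /SJ Sx||x y _ IHx _ IHy|x _ IHx].
- exact: generated_mem.
- by rewrite conj1g; apply: generated_one.
- by rewrite conjMg; apply: generated_mul.
- by rewrite conjVg; apply: generated_inv.
Qed.

Lemma lcs_rec1 n : lcs_rec n (1 : G).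
Proof. by case: n => [|n] //; apply: generated_one. Qed.

Lemma lcs_recM n x y : lcs_rec n x -> lcs_rec n y -> lcs_rec n (x * y).
Proof. by case: n => [|n] //; apply: generated_mul. Qed.

Lemma lcs_recV n x : lcs_rec n x -> lcs_rec n x^-1.
Proof. by case: n => [|n] //; apply: generated_inv. Qed.

Lemma lcs_recJ n x z : lcs_rec n x -> lcs_rec n (x ^ z).
Proof.
elim: n x z => [|n IHn] //= x z; apply: generatedJ => {}x [a an [b ->]].
by exists (a ^ z); [exact: IHn | exists (b ^ z); rewrite conjRg].
Qed.

Lemma lcs_recS n x : lcs_rec n.+1 x -> lcs_rec n x.
Proof.
elim=> {x} [x [a an [b ->]]||x y _ IHx _ IHy|x _ IHx].
- by rewrite commgEl; apply: lcs_recM (lcs_recV an) (lcs_recJ b an).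
- exact: lcs_rec1.
- exact: lcs_recM.
- exact: lcs_recV.
Qed.

(** The Hall-Witt identity expresses $[a,[c,d]]$ through
    $[[a,c^{-1}],d^{-1}]$ and $[[d^{-1},a^{-1}],c]$, which lie deep enough by
    induction on the depth of [c]. *)
Lemma lcs_recR m n x y :
  lcs_rec m x -> lcs_rec n y -> lcs_rec (m + n).+1 [~ x, y].
Proof.
elim: n m x y => [|n IHn] m x y xm.
  by rewrite addn0 => _; apply: generated_mem; exists x => //; exists y.
move=> yn; elim: yn x xm => {y} [y [c cn [d ->]]||y z _ IHy _ IHz|y _ IHy] a am.
- rewrite -invgR; apply: lcs_recV.
  have hw : [~ [~ c, d], a] = ((([~ [~ a, c^-1], d^-1] ^ c)^-1 *
      ([~ [~ d^-1, a^-1], c] ^ a)^-1)) ^ d.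
    by rewrite /commg /conjg !gnorm.
  rewrite hw; apply/lcs_recJ/lcs_recM/lcs_recV/lcs_recJ.
    apply/lcs_recV/lcs_recJ; rewrite addnS.
    apply: generated_mem; exists [~ a, c^-1]; last by exists d^-1.
    exact/IHn/lcs_recV.
  rewrite addnS -addSn; apply: IHn => //.
  rewrite -invgR; apply: lcs_recV.
  by apply: generated_mem; exists a^-1; [exact: lcs_recV | exists d^-1].
- by rewrite commg1; apply: lcs_rec1.
- have -> : [~ a, y * z] = [~ a, z] * [~ a, y] ^ z.
    by rewrite /commg /conjg !gnorm.
  by apply: lcs_recM (IHz a am) (lcs_recJ _ (IHy a am)).
- have -> : [~ a, y^-1] = ([~ a, y] ^ y^-1)^-1.
    by rewrite /commg /conjg !gnorm.
  exact/lcs_recV/lcs_recJ/IHy.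
Qed.

Lemma lcs1 q : lcs q (1 : G).
Proof. exact: lcs_rec1. Qed.

Lemma lcsM q x y : lcs q x -> lcs q y -> lcs q (x * y).
Proof. exact: lcs_recM. Qed.

Lemma lcsV q x : lcs q x -> lcs q x^-1.
Proof. exact: lcs_recV. Qed.

Lemma lcsJ q x z : lcs q x -> lcs q (x ^ z).
Proof. exact: lcs_recJ. Qed.

Lemma lcs_le p q x : (p <= q)%N -> lcs q x -> lcs p x.
Proof.
case: p => [|p] //; case: q => // q; rewrite ltnS /lcs /=.
elim: q => [|q IHq]; first by rewrite leqn0 => /eqP->.
by rewrite leq_eqVlt => /predU1P[-> //|pq] /lcs_recS; apply: IHq.
Qed.

Lemma lcsR p q x y : lcs p x -> lcs q y -> lcs (p + q) [~ x, y].
Proof.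
case: p => [|p] xp yq.
  by rewrite commgEr; apply: lcsM (lcsJ _ (lcsV yq)) yq.
case: q yq => [|q] yq.
  by rewrite addn0 commgEl; apply: lcsM (lcsV xp) (lcsJ _ xp).
by rewrite addnS; apply: lcs_recR.
Qed.

Lemma lcsW x : lcs 1 x. Proof. by []. Qed.

Lemma eqm_refl q x : eq_mod_lcs q x x.
Proof. by rewrite /eq_mod_lcs mulVg; apply: lcs1. Qed.

Lemma eqm_sym q x y : eq_mod_lcs q x y -> eq_mod_lcs q y x.
Proof. by move=> /lcsV; rewrite invgM invgK. Qed.

Lemma eqm_trans q y x z :
  eq_mod_lcs q x y -> eq_mod_lcs q y z -> eq_mod_lcs q x z.
Proof. by move=> xy yz; have := lcsM xy yz; rewrite mulgA mulgK. Qed.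

Lemma eqm_mul q x x' y y' : eq_mod_lcs q x x' -> eq_mod_lcs q y y' ->
  eq_mod_lcs q (x * y) (x' * y').
Proof.
move=> xx yy; rewrite /eq_mod_lcs.
have -> : (x * y)^-1 * (x' * y') = (x^-1 * x') ^ y * (y^-1 * y').
  by rewrite /conjg !gnorm.
exact: lcsM (lcsJ _ xx) yy.
Qed.

Lemma eqm1 q x : lcs q x -> eq_mod_lcs q x 1.
Proof. by rewrite /eq_mod_lcs mulg1; apply: lcsV. Qed.

Lemma eqmJ n p q x y : (n <= p + q)%N -> lcs p x -> lcs q y ->
  eq_mod_lcs n (x ^ y) x.
Proof.
move=> npq xp yq; apply: lcs_le npq _.
have -> : (x ^ y)^-1 * x = [~ x, y]^-1 by rewrite /commg !gnorm.
exact/lcsV/lcsR.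
Qed.

Lemma eqm_commute n p q x y : (n <= p + q)%N -> lcs p x -> lcs q y ->
  eq_mod_lcs n (x * y) (y * x).
Proof.
move=> npq xp yq; apply: lcs_le npq _.
have -> : (x * y)^-1 * (y * x) = [~ y, x] by rewrite /commg /conjg !gnorm.
by rewrite addnC; apply: lcsR.
Qed.

Lemma commg_perturb p q k u v u' v' : (0 < p)%N -> (0 < q)%N -> (0 < k)%N ->
  lcs p u -> lcs q v -> lcs (p + k) u' -> lcs (q + k) v' ->
  eq_mod_lcs (p + q + k).+1
    ([~ u, v]^-1 * [~ u * u', v * v']) ([~ u', v] * [~ u, v']).
Proof.
move=> p0 q0 k0 up vq u'p v'q; set n := (_ + _).+1.
have -> : [~ u * u', v * v'] = ([~ u, v'] * [~ u, v] ^ v') ^ u' *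
    ([~ u', v'] * [~ u', v] ^ v') by rewrite /commg /conjg !gnorm.
have h1 := lcsR up v'q; have h2 := lcsR up vq; have h3 := lcsR u'p vq.
have h4 := lcsR u'p v'q.
have e1 : eq_mod_lcs n (([~ u, v'] * [~ u, v] ^ v') ^ u')
    ([~ u, v'] * [~ u, v]).
  apply: (@eqm_trans _ ([~ u, v'] * [~ u, v] ^ v')).
    apply: (@eqmJ _ (p + q) (p + k)) u'p; first by rewrite /n; lia.
    by apply: lcsM (lcsJ _ h2); apply: lcs_le h1; lia.
  apply/(eqm_mul (eqm_refl _ _))/(eqmJ _ h2 v'q); rewrite /n; lia.
have e2 : eq_mod_lcs n ([~ u', v'] * [~ u', v] ^ v') [~ u', v].
  rewrite -[X in eq_mod_lcs _ _ X]mul1g; apply: eqm_mul.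
    by apply/eqm1/lcs_le/h4; rewrite /n; lia.
  by apply: eqmJ h3 v'q; rewrite /n; lia.
have e3 := eqm_mul e1 e2.
apply: eqm_trans (eqm_mul (eqm_refl _ _) e3) _.
set a := [~ u, v'] in h1 *; set b := [~ u, v] in h2 *.
set c := [~ u', v] in h3 *.
have -> : b^-1 * (a * b * c) = (a ^ b) * c by rewrite /conjg !gnorm.
apply: (@eqm_trans _ (a * c)).
  by apply: eqm_mul (eqm_refl _ _); apply: eqmJ h1 h2; rewrite /n; lia.
by apply: eqm_commute h1 h3; rewrite /n; lia.
Qed.
End LowerCentralSeriesTheory.

Lemma gmorph1 (G H : groupType) (h : G -> H) :
  {morph h : u v / (u * v)%g} -> h 1%g = 1%g.
Proof. by move=> hM; apply: (mulgI (h 1%g)); rewrite -hM !mulg1. Qed.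

Lemma gmorphV (G H : groupType) (h : G -> H) :
  {morph h : u v / (u * v)%g} -> {morph h : u / (u^-1)%g}.
Proof.
by move=> hM u; apply: (mulgI (h u)); rewrite -hM !mulgV gmorph1.
Qed.

Lemma gmorphR (G H : groupType) (h : G -> H) :
  {morph h : u v / (u * v)%g} -> {morph h : u v / commg u v}.
Proof. by move=> hM u v; rewrite /commg /conjg !(hM, gmorphV hM). Qed.

Lemma gmorphJ (G H : groupType) (h : G -> H) :
  {morph h : u v / (u * v)%g} -> {morph h : u v / (u ^ v)%g}.
Proof. by move=> hM u v; rewrite /conjg !(hM, gmorphV hM). Qed.

Lemma lcs_morph (G H : groupType) (h : G -> H) :
  {morph h : u v / (u * v)%g} -> forall q u, lcs q u -> lcs q (h u).
Proof.
move=> hM [|q] // u; rewrite /lcs /=.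
elim: q u => [|q IHq] // u; elim=> {u} [u [a aq [b ->]]||u v _ IHu _ IHv|u _ IHu].
- by rewrite gmorphR //; apply: generated_mem; exists (h a); [exact: IHq|exists (h b)].
- by rewrite gmorph1 //; apply: generated_one.
- by rewrite hM; apply: generated_mul.
- by rewrite gmorphV //; apply: generated_inv.
Qed.

Lemma eqm_morph (G H : groupType) (h : G -> H) :
  {morph h : u v / (u * v)%g} ->
  forall q u v, eq_mod_lcs q u v -> eq_mod_lcs q (h u) (h v).
Proof.
by move=> hM q u v /(lcs_morph hM); rewrite hM gmorphV.
Qed.

(** * Free Lie algebras *)

Section AdditiveMaps.
Variables (A B : zmodType) (f : A -> B).
Hypothesis fD : {morph f : x y / x + y}.

Lemma add_morph0 : f 0 = 0.
Proof. by apply: (addrI (f 0)); rewrite -fD !addr0. Qed.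

Lemma add_morphN : {morph f : x / - x}.
Proof. by move=> x; apply: (addrI (f x)); rewrite -fD !subrr add_morph0. Qed.

Lemma add_morphB : {morph f : x y / x - y}.
Proof. by move=> x y; rewrite fD add_morphN. Qed.

Lemma add_morphMz z : {morph f : x / x *~ z}.
Proof.
have fX n : {morph f : x / x *+ n}.
  by elim: n => [|n IH] x; rewrite ?add_morph0 // !mulrS fD IH.
by case: z => n x; rewrite /intmul ?add_morphN fX.
Qed.

Lemma add_morph_sum I (r : seq I) (P : pred I) (F : I -> A) :
  f (\sum_(i <- r | P i) F i) = \sum_(i <- r | P i) f (F i).
Proof. by apply: big_morph; [exact: fD | exact: add_morph0]. Qed.
End AdditiveMaps.

Section FreeLieTheory.
Variable V : zmodType.
Implicit Types x y z : free_lie V.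

Lemma lie_br0l x : lie_br 0 x = 0.
Proof. exact (@add_morph0 _ _ (fun u => lie_br u x) (fun u v => lie_brDl u v x)). Qed.
Lemma lie_br0r x : lie_br x 0 = 0.
Proof. exact: (add_morph0 (lie_brDr x)). Qed.
Lemma lie_brNl x y : lie_br (- x) y = - lie_br x y.
Proof. exact (@add_morphN _ _ (fun u => lie_br u y) (fun u v => lie_brDl u v y) x). Qed.
Lemma lie_brNr x y : lie_br x (- y) = - lie_br x y.
Proof. exact: (add_morphN (lie_brDr x)). Qed.

Lemma lie_brC x y : lie_br x y = - lie_br y x.
Proof.
apply/eqP; rewrite -addr_eq0; apply/eqP.
by have := lie_brxx (x + y); rewrite lie_brDl !lie_brDr !lie_brxx add0r addr0.
Qed.

Lemma lie_br_brl x y z :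
  lie_br (lie_br x y) z = lie_br x (lie_br y z) - lie_br y (lie_br x z).
Proof.
have /eqP := lie_jacobi x y z.
rewrite (lie_brC z (lie_br x y)) addrA subr_eq0 => /eqP <-.
by rewrite (lie_brC z x) lie_brNr.
Qed.

Lemma lie_gen0 : lie_gen (0 : V) = 0.
Proof. exact: add_morph0 (@lie_genD V). Qed.
Lemma lie_genN (v : V) : lie_gen (- v) = - lie_gen v.
Proof. exact: add_morphN (@lie_genD V) v. Qed.

Definition lie_of (a : lie_term V) : free_lie V := \pi_(free_lie V) a.

Lemma lie_ofD a b : lie_of (LieAdd a b) = lie_of a + lie_of b.
Proof. by rewrite [RHS]fl_add_pi. Qed.

Lemma lie_ofN a : lie_of (LieOpp a) = - lie_of a.
Proof. by rewrite [RHS]fl_opp_pi. Qed.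

Lemma lie_of_br a b : lie_of (LieBr a b) = lie_br (lie_of a) (lie_of b).
Proof. by rewrite [RHS]lie_br_pi. Qed.

Lemma lie_of_eq a b : lie_eq a b -> lie_of a = lie_of b.
Proof. by move/free_lie_eqP. Qed.

Lemma free_lie_ind (P : free_lie V -> Prop) :
  (forall v, P (lie_gen v)) -> P 0 -> (forall x y, P x -> P y -> P (x + y)) ->
  (forall x, P x -> P (- x)) -> (forall x y, P x -> P y -> P (lie_br x y)) ->
  forall x, P x.
Proof.
move=> Pg P0 PD PN Pb; elim/quotW=> a; rewrite -/(lie_of a).
elim: a => [v||a IHa b IHb|a IHa|a IHa b IHb].
- exact: Pg.
- exact: P0.
- by rewrite lie_ofD; apply: PD.
- by rewrite lie_ofN; apply: PN.
- by rewrite lie_of_br; apply: Pb.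
Qed.
End FreeLieTheory.

(** The universal property of the free Lie algebra. *)
Section LieLift.
Variables (V M : zmodType) (tau : V -> M) (beta : M -> M -> M).

Fixpoint lie_eval (a : lie_term V) : M :=
  match a with
  | LieGen v => tau v
  | LieZero => 0
  | LieAdd a b => lie_eval a + lie_eval b
  | LieOpp a => - lie_eval a
  | LieBr a b => beta (lie_eval a) (lie_eval b)
  end.

Definition lie_lift (x : free_lie V) : M := lie_eval (repr x).

Hypothesis tauD : {morph tau : u v / u + v}.
Hypothesis betaDl : forall x y z, beta (x + y) z = beta x z + beta y z.
Hypothesis betaDr : forall x y z, beta x (y + z) = beta x y + beta x z.
Hypothesis betaxx : forall x, beta x x = 0.
Hypothesis beta_jacobi : forall x y z,
  beta x (beta y z) + (beta y (beta z x) + beta z (beta x y)) = 0.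

Lemma lie_eval_eq a b : lie_eq a b -> lie_eval a = lie_eval b.
Proof.
elim=> {a b} //=; try (by move=> *; congruence);
  by move=> *; rewrite ?addrA ?add0r ?addNr // 1?addrC.
Qed.

Lemma lie_lift_pi a : lie_lift (\pi_(free_lie V) a) = lie_eval a.
Proof. exact/lie_eval_eq/repr_lie. Qed.

Lemma lie_lift_gen v : lie_lift (lie_gen v) = tau v.
Proof. exact: lie_lift_pi. Qed.

Lemma lie_liftD : {morph lie_lift : x y / x + y}.
Proof.
move=> x y; elim/quotW: x => x; elim/quotW: y => y.
by rewrite -/(lie_of x) -/(lie_of y) -lie_ofD !lie_lift_pi.
Qed.

Lemma lie_lift_br x y :
  lie_lift (lie_br x y) = beta (lie_lift x) (lie_lift y).
Proof.
by elim/quotW: x => x; elim/quotW: y => y; rewrite lie_br_pi !lie_lift_pi.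
Qed.
End LieLift.

Section LieMap.
Variables (V W : zmodType) (f : V -> W).
Hypothesis fD : {morph f : u v / u + v}.

Definition lie_map : free_lie V -> free_lie W :=
  lie_lift (fun v => lie_gen (f v)) (@lie_br W).

Let gfD : {morph (fun v => lie_gen (f v)) : u v / u + v}.
Proof. by move=> u v; rewrite fD lie_genD. Qed.

Lemma lie_map_gen v : lie_map (lie_gen v) = lie_gen (f v).
Proof.
by apply: lie_lift_gen => // *; rewrite ?lie_brDl ?lie_brDr ?lie_brxx ?lie_jacobi.
Qed.

Lemma lie_mapD : {morph lie_map : x y / x + y}.
Proof.
by apply: lie_liftD => // *; rewrite ?lie_brDl ?lie_brDr ?lie_brxx ?lie_jacobi.
Qed.

Lemma lie_map_br x y : lie_map (lie_br x y) = lie_br (lie_map x) (lie_map y).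
Proof.
by apply: lie_lift_br => // *; rewrite ?lie_brDl ?lie_brDr ?lie_brxx ?lie_jacobi.
Qed.
End LieMap.

Lemma lie_map_id (V : zmodType) (x : free_lie V) : lie_map id x = x.
Proof.
have idD : {morph (@id V) : u v / u + v} by [].
elim/free_lie_ind: x => [v||x y hx hy|x hx|x y hx hy].
- exact: lie_map_gen.
- exact: add_morph0 (lie_mapD idD).
- by rewrite lie_mapD // hx hy.
- by rewrite (add_morphN (lie_mapD idD)) hx.
- by rewrite lie_map_br // hx hy.
Qed.

Section Derivation.
Variables (V : zmodType) (tau : V -> free_lie V).
Hypothesis tauD : {morph tau : u v / u + v}.
Local Notation L := (free_lie V).

Let beta (x y : L * L) : L * L :=
  (lie_br x.1 y.1, lie_br x.2 y.1 + lie_br x.1 y.2).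
Let tau2 (v : V) : L * L := (lie_gen v, tau v).

(** A derivation of a Lie algebra [L] is a section of the first projection
    from [L] tensored with the dual numbers, which is how the derivation
    extending [tau] is obtained from the universal property. *)
Definition lie_der (x : L) : L := (lie_lift tau2 beta x).2.

Let tau2D : {morph tau2 : u v / u + v}.
Proof. by move=> u v; congr (_, _); [exact: lie_genD | exact: tauD]. Qed.
Let betaDl x y z : beta (x + y) z = beta x z + beta y z.
Proof. by congr (_, _); rewrite /= !lie_brDl // addrACA. Qed.
Let betaDr x y z : beta x (y + z) = beta x y + beta x z.
Proof. by congr (_, _); rewrite /= !lie_brDr // addrACA. Qed.
Let betaxx x : beta x x = 0.
Proof.
by congr (_, _); rewrite /= ?lie_brxx // (lie_brC x.1 x.2) subrr.
Qed.
Let beta_jacobi x y z :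
  beta x (beta y z) + (beta y (beta z x) + beta z (beta x y)) = 0.
Proof.
case: x y z => [x x'] [y y'] [z z']; congr (_, _) => /=.
  exact: lie_jacobi.
rewrite !lie_brDr.
have regroup (a b c d e f g h i : free_lie V) :
    a + (b + c) + (d + (e + f) + (g + (h + i))) =
    (a + (f + h)) + ((b + (d + i)) + (c + (e + g))).
  by rewrite !addrA [LHS](ACl (1*6*8*2*4*9*3*5*7)).
rewrite [LHS]regroup.
by rewrite !lie_jacobi !addr0.
Qed.

Let lift1 x : (lie_lift tau2 beta x).1 = x.
Proof.
elim/free_lie_ind: x => [v||x y hx hy|x hx|x y hx hy].
- by rewrite lie_lift_gen.
- by rewrite (add_morph0 (lie_liftD _ _ _ _ _)).
- by rewrite lie_liftD //= hx hy.
- by rewrite (add_morphN (lie_liftD _ _ _ _ _)) //= hx.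
- by rewrite lie_lift_br //= hx hy.
Qed.

Lemma lie_der_gen v : lie_der (lie_gen v) = tau v.
Proof. by rewrite /lie_der lie_lift_gen. Qed.

Lemma lie_derD : {morph lie_der : x y / x + y}.
Proof. by move=> x y; rewrite /lie_der lie_liftD. Qed.

Lemma lie_der_br x y :
  lie_der (lie_br x y) = lie_br (lie_der x) y + lie_br x (lie_der y).
Proof. by rewrite {1}/lie_der lie_lift_br //= !lift1. Qed.
End Derivation.

(** * Cutting trees open at their leaves *)

Section Cut.
Variables (V M : zmodType) (f : V -> free_lie V -> M).
Implicit Types A B C : free_lie V.

(** [a] and [B] are rooted trees with leaves in [V], with [B] known as a Lie
    element only. [cut_term a B] sums [f v C] over the leaves [v] of [a], where
    [C] is the Lie element read off from that leaf in the tree that joins the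
    roots of [a] and [B] by an edge. *)
Fixpoint cut_term (a : lie_term V) (B : free_lie V) : M :=
  match a with
  | LieGen v => f v B
  | LieZero => 0
  | LieAdd a b => cut_term a B + cut_term b B
  | LieOpp a => - cut_term a B
  | LieBr a b => cut_term a (lie_br (lie_of b) B) + cut_term b (lie_br B (lie_of a))
  end.

Definition cut (A B : free_lie V) : M := cut_term (repr A) B.

(** The leaves on both sides of the edge that joins the roots of [A] and [B]. *)
Definition tree (A B : free_lie V) : M := cut A B + cut B A.

Hypothesis fDl : forall u v B, f (u + v) B = f u B + f v B.
Hypothesis fDr : forall v, {morph f v : B C / B + C}.

Let cut_termD a : {morph cut_term a : B C / B + C}.
Proof.
elim: a => [v||a IHa b IHb|a IHa|a IHa b IHb] B C /=.
- exact: fDr.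
- by rewrite addr0.
- by rewrite IHa IHb addrACA.
- by rewrite IHa opprD.
- by rewrite lie_brDr lie_brDl IHa IHb addrACA.
Qed.

Let cut_term_eq a b : lie_eq a b -> forall B, cut_term a B = cut_term b B.
Proof.
elim=> {a b} //=; try by move=> *; rewrite ?addrA ?add0r ?addNr // 1?addrC.
- by move=> a b c _ h1 _ h2 B; rewrite h1 h2.
- by move=> a a' b b' _ h1 _ h2 B; rewrite h1 h2.
- by move=> a a' _ h B; rewrite h.
- by move=> a a' b b' /lie_of_eq e1 h1 /lie_of_eq e2 h2 B; rewrite h1 h2 e1 e2.
- by move=> a b c B; rewrite lie_ofD lie_brDr cut_termD addrACA.
- by move=> a b c B; rewrite lie_ofD lie_brDl cut_termD addrACA.
- move=> a B; rewrite -cut_termD (lie_brC B) subrr.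
  exact: add_morph0 (cut_termD a).
- move=> a b c B; rewrite !lie_of_br.
  set x := lie_of a; set y := lie_of b; set z := lie_of c.
  have jac d u v : cut_term d (lie_br (lie_br u v) B) +
      cut_term d (lie_br (lie_br B u) v) + cut_term d (lie_br u (lie_br B v)) = 0.
    rewrite -!cut_termD (lie_br_brl B) (lie_brC _ B) addrA addNr sub0r addNr.
    exact: add_morph0 (cut_termD d).
  have regroup (a1 a2 a3 b1 b2 b3 c1 c2 c3 : M) :
      a1 + (b1 + c1) + (b2 + (c2 + a2) + (c3 + (a3 + b3))) =
      (a1 + a2 + a3) + ((b2 + b3 + b1) + (c3 + c1 + c2)).
    by rewrite !addrA [LHS](ACl (1*6*8*4*9*2*7*3*5)).
  by rewrite regroup !jac !addr0.
Qed.

Let cut_of a B : cut (lie_of a) B = cut_term a B.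
Proof. exact/cut_term_eq/repr_lie. Qed.

Lemma cut_gen v B : cut (lie_gen v) B = f v B.
Proof. exact: cut_of. Qed.

Lemma cutDl A A' B : cut (A + A') B = cut A B + cut A' B.
Proof.
elim/quotW: A => a; elim/quotW: A' => a'; rewrite -!/(lie_of _).
by rewrite -lie_ofD !cut_of.
Qed.

Lemma cutDr A : {morph cut A : B C / B + C}.
Proof. exact: cut_termD. Qed.

Lemma cut_br A A' B :
  cut (lie_br A A') B = cut A (lie_br A' B) + cut A' (lie_br B A).
Proof.
elim/quotW: A => a; elim/quotW: A' => a'; rewrite -!/(lie_of _).
by rewrite -lie_of_br !cut_of.
Qed.

Lemma cut0l B : cut 0 B = 0.
Proof. exact (@add_morph0 _ _ (fun A => cut A B) (fun A A' => cutDl A A' B)). Qed.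
Lemma cut0r A : cut A 0 = 0.
Proof. exact (add_morph0 (cutDr A)). Qed.
Lemma cutNl A B : cut (- A) B = - cut A B.
Proof. exact (@add_morphN _ _ (fun A => cut A B) (fun A A' => cutDl A A' B) A). Qed.
Lemma cutNr A B : cut A (- B) = - cut A B.
Proof. exact (add_morphN (cutDr A) B). Qed.

Lemma treeC A B : tree A B = tree B A.
Proof. by rewrite /tree addrC. Qed.
Lemma treeDl A A' B : tree (A + A') B = tree A B + tree A' B.
Proof. by rewrite /tree cutDl cutDr addrACA. Qed.
Lemma treeDr A B B' : tree A (B + B') = tree A B + tree A B'.
Proof. by rewrite !(treeC A) treeDl. Qed.
Lemma treeNl A B : tree (- A) B = - tree A B.
Proof. by rewrite /tree cutNl cutNr opprD. Qed.
Lemma treeNr A B : tree A (- B) = - tree A B.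
Proof. by rewrite !(treeC A) treeNl. Qed.
Lemma tree0l B : tree 0 B = 0.
Proof. by rewrite /tree cut0l cut0r addr0. Qed.
Lemma tree0r B : tree B 0 = 0.
Proof. by rewrite treeC tree0l. Qed.

(** Both sides describe the same trivalent tree, cut at different edges. *)
Lemma tree_slide A A' B : tree (lie_br A A') B = tree A (lie_br A' B).
Proof. by rewrite /tree !cut_br addrA. Qed.
End Cut.

Section CutNaturality.
Variables (V W M N : zmodType).
Variables (f : V -> free_lie V -> M) (f' : W -> free_lie W -> N).
Variables (p : V -> W) (G : M -> N).
Hypothesis fDl : forall u v B, f (u + v) B = f u B + f v B.
Hypothesis fDr : forall v, {morph f v : B C / B + C}.
Hypothesis f'Dl : forall u v B, f' (u + v) B = f' u B + f' v B.
Hypothesis f'Dr : forall v, {morph f' v : B C / B + C}.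
Hypothesis pD : {morph p : u v / u + v}.
Hypothesis GD : {morph G : x y / x + y}.
Hypothesis fG : forall v B, G (f v B) = f' (p v) (lie_map p B).

Lemma cut_natural A B :
  G (cut f A B) = cut f' (lie_map p A) (lie_map p B).
Proof.
elim/free_lie_ind: A B => [v||A A' hA hA'|A hA|A A' hA hA'] B.
- by rewrite lie_map_gen // !cut_gen.
- by rewrite (add_morph0 (lie_mapD pD)) !cut0l ?(add_morph0 GD).
- by rewrite lie_mapD // !cutDl // GD hA hA'.
- by rewrite (add_morphN (lie_mapD pD)) !cutNl // (add_morphN GD) hA.
- by rewrite lie_map_br // !cut_br // GD hA hA' !lie_map_br.
Qed.

Lemma tree_natural A B :
  G (tree f A B) = tree f' (lie_map p A) (lie_map p B).
Proof. by rewrite /tree GD !cut_natural. Qed.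
End CutNaturality.

Section CutImage.
Variables (V M N : zmodType) (f : V -> free_lie V -> M) (f' : V -> free_lie V -> N).
Variable G : M -> N.
Hypothesis fDl : forall u v B, f (u + v) B = f u B + f v B.
Hypothesis fDr : forall v, {morph f v : B C / B + C}.
Hypothesis f'Dl : forall u v B, f' (u + v) B = f' u B + f' v B.
Hypothesis f'Dr : forall v, {morph f' v : B C / B + C}.
Hypothesis GD : {morph G : x y / x + y}.
Hypothesis fG : forall v B, G (f v B) = f' v B.

Lemma tree_image A B : G (tree f A B) = tree f' A B.
Proof.
have idD : {morph (@id V) : u v / u + v} by [].
rewrite (tree_natural fDl fDr f'Dl f'Dr idD GD) ?lie_map_id // => v C.
by rewrite lie_map_id fG.
Qed.
End CutImage.

(** * The grading of a free Lie algebra *)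

(** The terms cancel in pairs; [lt] picks one member of each pair. *)
Lemma sum_alternating (I : finType) (M : zmodType) (P : pred (I * I))
    (F : I -> I -> M) (lt : rel I) :
  (forall i j, i != j -> lt i j = ~~ lt j i) ->
  (forall i j, P (i, j) = P (j, i)) ->
  (forall i j, F i j = - F j i) -> (forall i, F i i = 0) ->
  \sum_(p | P p) F p.1 p.2 = 0.
Proof.
move=> ltC PC FC Fxx; rewrite (bigID (fun p : I * I => p.1 == p.2)) /=.
rewrite big1 ?add0r; last by move=> [i j] /= /andP[_ /eqP->].
rewrite (bigID (fun p : I * I => lt p.1 p.2)) /=.
rewrite [X in _ + X](reindex_inj (h := fun p : I * I => (p.2, p.1))) /=; last first.
  by move=> [i j] [i' j'] [-> ->].
rewrite [X in _ + X](eq_big (fun p => P p && (p.1 != p.2) && lt p.1 p.2)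
    (fun p => - F p.1 p.2)); first by rewrite sumrN subrr.
- case=> i j /=; rewrite PC (eq_sym j).
  by case: (eqVneq i j) => [->|ij]; rewrite ?andbF ?(ltC i j ij).
- by move=> p _; rewrite FC.
Qed.

Section Grading.
Variables (V : zmodType) (N : nat).
Local Notation L := (free_lie V).
Local Notation I := 'I_N.+1.

Let gr_gen (v : V) : {ffun I -> L} :=
  [ffun n : I => if n == 1%N :> nat then lie_gen v else 0].
Let gr_br (x y : {ffun I -> L}) : {ffun I -> L} :=
  [ffun n : I => \sum_(p : I * I | (p.1 + p.2 == n)%N) lie_br (x p.1) (y p.2)].

Let gr_genD : {morph gr_gen : u v / u + v}.
Proof.
by move=> u v; apply/ffunP=> n; rewrite !ffunE lie_genD; case: ifP; rewrite ?addr0.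
Qed.

Let gr_brDl x y z : gr_br (x + y) z = gr_br x z + gr_br y z.
Proof.
apply/ffunP=> n; rewrite !ffunE -big_split.
by apply: eq_bigr => p _; rewrite ffunE lie_brDl.
Qed.

Let gr_brDr x y z : gr_br x (y + z) = gr_br x y + gr_br x z.
Proof.
apply/ffunP=> n; rewrite !ffunE -big_split.
by apply: eq_bigr => p _; rewrite ffunE lie_brDr.
Qed.

Let gr_brxx x : gr_br x x = 0.
Proof.
apply/ffunP=> n; rewrite !ffunE.
apply: (sum_alternating (F := fun i j => lie_br (x i) (x j))
  (lt := fun i j => i < j)%N) => [i j|i j|i j|i].
- by rewrite -val_eqE /=; case: ltngtP.
- by rewrite addnC.
- exact: lie_brC.
- exact: lie_brxx.
Qed.

Let gr_br3 x y z n : gr_br x (gr_br y z) n =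
  \sum_(t : I * (I * I) | (t.1 + (t.2.1 + t.2.2) == n)%N)
    lie_br (x t.1) (lie_br (y t.2.1) (z t.2.2)).
Proof.
rewrite ffunE /= [RHS](partition_big
  (fun t : I * (I * I) => (t.1, inord (t.2.1 + t.2.2) : I))
  (fun p => p.1 + p.2 == n)%N) /=; last first.
  move=> [i [j m]] /= /eqP e; rewrite inordK ?e //.
  by have := ltn_ord n; lia.
apply: eq_bigr => -[i l] /= /eqP il; rewrite ffunE (add_morph_sum (lie_brDr _)).
rewrite [RHS](reindex (fun p : I * I => (i, p))) /=; last first.
  exists snd => [//|[i' p]]; rewrite inE xpair_eqE /=.
  by case/and3P=> _ /eqP-> _.
apply: eq_bigl => -[j m] /=; rewrite xpair_eqE eqxx /=.
have lN := ltn_ord l; have nN := ltn_ord n.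
apply/eqP/andP => [jm|[/eqP ijm /eqP <-]].
  by rewrite jm il eqxx; split=> //; apply/eqP/val_inj; rewrite /= inordK ?jm.
by rewrite inordK //; lia.
Qed.

Let gr_jacobi x y z :
  gr_br x (gr_br y z) + (gr_br y (gr_br z x) + gr_br z (gr_br x y)) = 0.
Proof.
pose rot (t : I * (I * I)) : I * (I * I) := (t.2.1, (t.2.2, t.1)).
have rotI : injective rot by move=> [i [j m]] [i' [j' m']] [-> -> ->].
have addE (f h : {ffun I -> L}) m : (f + h) m = f m + h m by rewrite ffunE.
apply/ffunP=> n; rewrite [RHS]ffunE !addE !gr_br3.
rewrite [X in _ + (X + _)](reindex_inj rotI) /=.
rewrite [X in _ + (_ + X)](reindex_inj rotI) (reindex_inj rotI) /=.
rewrite [X in _ + (X + _)](eq_bigl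
  (fun t : I * (I * I) => t.1 + (t.2.1 + t.2.2) == n)%N); last first.
  by move=> [i [j m]] /=; congr (_ == _); lia.
rewrite [X in _ + (_ + X)](eq_bigl
  (fun t : I * (I * I) => t.1 + (t.2.1 + t.2.2) == n)%N); last first.
  by move=> [i [j m]] /=; congr (_ == _); lia.
by rewrite -!big_split big1 // => t _; rewrite /= lie_jacobi.
Qed.

(** The component of degree [n]. Degrees above the fixed bound [N] are cut
    off, so that the components form a finitely indexed family. *)
Definition lie_comp (n : I) (x : L) : L := lie_lift gr_gen gr_br x n.

Lemma lie_compD n : {morph lie_comp n : x y / x + y}.
Proof. by move=> x y; rewrite /lie_comp lie_liftD // ffunE. Qed.

Lemma lie_comp_gen n v :
  lie_comp n (lie_gen v) = if n == 1%N :> nat then lie_gen v else 0.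
Proof. by rewrite /lie_comp lie_lift_gen // ffunE. Qed.

Lemma lie_comp_br n x y : lie_comp n (lie_br x y) =
  \sum_(p : I * I | (p.1 + p.2 == n)%N) lie_br (lie_comp p.1 x) (lie_comp p.2 y).
Proof. by rewrite /lie_comp lie_lift_br // ffunE. Qed.

Lemma lie_homogN q (x : L) : lie_homog q x -> lie_homog q (- x).
Proof. by rewrite -sub0r; apply: lie_homog_sub (lie_homog_zero _ _). Qed.

Lemma lie_homogD q (x y : L) :
  lie_homog q x -> lie_homog q y -> lie_homog q (x + y).
Proof. by move=> xq /lie_homogN; rewrite -{2}[y]opprK; apply: lie_homog_sub. Qed.

Lemma lie_comp_homog (n : I) x : lie_homog n (lie_comp n x).
Proof.
elim/free_lie_ind: x n => [v||x y hx hy|x hx|x y hx hy] n.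
- by rewrite lie_comp_gen; case: eqP => [->|_]; constructor.
- by rewrite (add_morph0 (lie_compD n)); constructor.
- by rewrite lie_compD; apply: lie_homogD.
- by rewrite (add_morphN (lie_compD n)); apply: lie_homogN.
- rewrite lie_comp_br.
  apply: (@big_ind _ (@lie_homog V n)) => [||p /eqP <-]; first exact: lie_homog_zero.
    exact: lie_homogD.
  exact: lie_homog_br.
Qed.

Lemma lie_comp_id (n : I) q x :
  lie_homog q x -> lie_comp n x = if n == q :> nat then x else 0.
Proof.
move=> xq; elim: xq n => {q x} [v|q|q x y _ hx _ hy|p q x y _ hx _ hy] n.
- exact: lie_comp_gen.
- by rewrite (add_morph0 (lie_compD n)) if_same.
- by rewrite (add_morphB (lie_compD n)) hx hy; case: eqP; rewrite ?subr0.
- rewrite lie_comp_br; case: eqP => [npq|npq].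
    have nN := ltn_ord n.
    have pN : (p < N.+1)%N by lia.
    have qN : (q < N.+1)%N by lia.
    rewrite (bigD1 (Ordinal pN, Ordinal qN)) /= ?npq // hx hy !eqxx /=.
    rewrite big1 ?addr0 // => -[i j] /= /andP[/eqP ij ne].
    rewrite hx hy; case: eqP => [ip|]; last by rewrite lie_br0l.
    case: eqP => [jq|]; last by rewrite lie_br0r.
    by case/eqP: ne; congr (_, _); apply: val_inj.
  apply: big1 => -[i j] /= /eqP ij; rewrite hx hy.
  case: eqP => [ip|]; last by rewrite lie_br0l.
  case: eqP => [jq|]; last by rewrite lie_br0r.
  by case: npq; rewrite -ij ip jq.
Qed.

Lemma lie_comp_br_gen (n m : I) v x : m = n.+1 :> nat ->
  lie_comp m (lie_br (lie_gen v) x) = lie_br (lie_gen v) (lie_comp n x).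
Proof.
move=> mn; rewrite lie_comp_br.
have lt1 : (1 < N.+1)%N by have := ltn_ord m; lia.
rewrite (bigD1 (Ordinal lt1, n)) /=; last by rewrite mn.
rewrite lie_comp_gen /= big1 ?addr0 // => -[i j] /= /andP[/eqP ij ne].
rewrite lie_comp_gen; case: eqP => [i1|]; last by rewrite lie_br0l.
by case/eqP: ne; congr (_, _); apply: val_inj => /=; lia.
Qed.

Definition lie_part_of (n : I) (x : L) : lie_part V n :=
  LiePart (asboolT (lie_comp_homog n x)).

Lemma lie_part_ofD n : {morph lie_part_of n : x y / x + y}.
Proof. by move=> x y; apply: val_inj; rewrite /= lie_compD. Qed.

Lemma lie_part_of_id (n : I) (x : lie_part V n) : lie_part_of n x = x.
Proof.
by apply: val_inj; case: x => x /= /asboolP xn; rewrite (lie_comp_id _ xn) eqxx.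
Qed.
End Grading.

(** * Subgroups of abelian groups given by generators *)

Inductive zspan (M : zmodType) (S : M -> Prop) : M -> Prop :=
| zspan_mem x : S x -> zspan S x
| zspan0 : zspan S 0
| zspanD x y : zspan S x -> zspan S y -> zspan S (x + y)
| zspanN x : zspan S x -> zspan S (- x).

Lemma zspanB (M : zmodType) (S : M -> Prop) x y :
  zspan S x -> zspan S y -> zspan S (x - y).
Proof. by move=> hx /zspanN; apply: zspanD. Qed.

Lemma zspan_additive (M M' : zmodType) (S : M -> Prop) (S' : M' -> Prop)
    (f : M -> M') : {morph f : x y / x + y} ->
  (forall x, S x -> zspan S' (f x)) -> forall x, zspan S x -> zspan S' (f x).
Proof.
move=> fD fS x; elim=> {x} [x /fS //||x y _ hx _ hy|x _ hx].
- by rewrite (add_morph0 fD); apply: zspan0.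
- by rewrite fD; apply: zspanD.
- by rewrite (add_morphN fD); apply: zspanN.
Qed.

(** * Generators of the kernel of the bracket *)

Section RightNormed.
Variables (V : zmodType) (I : Type) (e : I -> V).

Definition rnorm (w : seq I) (a : I) : free_lie V :=
  foldr (fun b x => lie_br (lie_gen (e b)) x) (lie_gen (e a)) w.

Lemma rnorm_homog w a : lie_homog (size w).+1 (rnorm w a).
Proof.
elim: w => [|b w IH] /=; first exact: lie_homog_gen.
exact: (lie_homog_br (lie_homog_gen (e b)) IH).
Qed.

Hypothesis e_span : forall v, zspan (fun u => exists i, u = e i) v.
Let rn_span := zspan (fun x => exists w a, x = rnorm w a).

Let rn_br a x : rn_span x -> rn_span (lie_br a x).
Proof.
elim/free_lie_ind: a x => [v||a b ha hb|a ha|a b ha hb] x.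
- move=> hx; apply: (zspan_additive (f := fun v => lie_br (lie_gen v) x))
    (e_span v) => [u u'|_ [i ->]].
    by rewrite lie_genD lie_brDl.
  apply: (zspan_additive (f := lie_br (lie_gen (e i)))) hx => [u u'|_ [w [c ->]]].
    by rewrite lie_brDr.
  by apply: zspan_mem; exists (i :: w), c.
- by rewrite lie_br0l => _; apply: zspan0.
- by rewrite lie_brDl => hx; apply: zspanD; [exact: ha | exact: hb].
- by rewrite lie_brNl => hx; apply/zspanN/ha.
- by rewrite lie_br_brl => hx; apply: zspanB; [exact/ha/hb | exact/hb/ha].
Qed.

(** By the Jacobi identity the right-normed brackets span a left ideal. *)
Lemma rnorm_span x : zspan (fun x => exists w a, x = rnorm w a) x.
Proof.
elim/free_lie_ind: x => [v||x y hx hy|x hx|x y hx hy].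
- apply: (zspan_additive (f := @lie_gen V)) (e_span v) => [u u'|_ [i ->]].
    exact: lie_genD.
  by apply: zspan_mem; exists [::], i.
- exact: zspan0.
- exact: zspanD.
- exact: zspanN.
- exact: rn_br.
Qed.
End RightNormed.

Section KernelOfBracket.
Variables (V : zmodType) (k : nat).
Local Notation L := (free_lie V).
Local Notation T := (tensor V (lie_part V k.+1)).

(* The degrees $k+1$ and $k+2$, among the components of degree at most $k+2$. *)
Let k1 : 'I_k.+3 := Ordinal (leqnSn k.+2).
Let k2 : 'I_k.+3 := ord_max.

(** The leaf function for which [tree] computes the element of the kernel of
    the bracket attached to a trivalent tree with $k+2$ leaves. *)
Definition pure_of (v : V) (B : L) : T := pure v (lie_part_of k1 B).

Lemma pure_ofDl u v B : pure_of (u + v) B = pure_of u B + pure_of v B.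
Proof. exact: pureDl. Qed.

Lemma pure_ofDr v : {morph pure_of v : B C / B + C}.
Proof. by move=> B C; rewrite /pure_of lie_part_ofD pureDr. Qed.

Lemma bracket_mapD : {morph @bracket_map V k : x y / x + y}.
Proof.
move=> x y; have b0 : bracket_map (0 : T) = 0.
  by rewrite -(subrr (0 : T)) bracket_mapB subrr.
by rewrite -{1}[y]opprK bracket_mapB -[- y]sub0r bracket_mapB b0 sub0r opprK.
Qed.

Lemma bracket_map_pure v (B : lie_part V k.+1) :
  bracket_map (pure v B) = lie_br (lie_gen v) B.
Proof.
by apply: tensor_lift_pure => *; rewrite ?lie_genD ?lie_brDl ?raddfD ?lie_brDr.
Qed.

Let fDl : forall u v B, pure_of (u + v) B = pure_of u B + pure_of v B.
Proof. exact: pure_ofDl. Qed.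
Let fDr : forall v, {morph pure_of v : B C / B + C}.
Proof. exact: pure_ofDr. Qed.

(** Rooting the tree at a leaf [v] and bracketing with [v] expands, over all
    the leaves of [A], to the single bracket along the edge from [A] to [B]. *)
Lemma bracket_map_cut A B :
  bracket_map (cut pure_of A B) = lie_comp k2 (lie_br A B).
Proof.
elim/free_lie_ind: A B => [v||A A' hA hA'|A hA|A A' hA hA'] B;
  have cD := @lie_compD V _ k2.
- by rewrite cut_gen // bracket_map_pure (@lie_comp_br_gen _ _ k1).
- by rewrite cut0l // lie_br0l (add_morph0 cD) (add_morph0 bracket_mapD).
- by rewrite cutDl // bracket_mapD hA hA' lie_brDl cD.
- by rewrite cutNl // (add_morphN bracket_mapD) hA lie_brNl (add_morphN cD).
- rewrite cut_br // bracket_mapD hA hA' -cD.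
  by rewrite lie_br_brl (lie_brC B A) lie_brNr.
Qed.

(** A bracket can be moved into the form $[v,B]$ with [v] in [V] by the Jacobi
    identity; [uncut] records the tensors $v\otimes B$ that result. This choice
    respects the relations of the free Lie algebra only up to the elements
    [cut pure_of A A]. *)
Fixpoint uncut (a : lie_term V) : T :=
  match a with
  | LieGen _ => 0
  | LieZero => 0
  | LieAdd a b => uncut a + uncut b
  | LieOpp a => - uncut a
  | LieBr a b => cut pure_of (lie_of a) (lie_of b)
  end.

Let R := zspan (fun x => exists A, x = cut pure_of A A).

(* Polarization of [cut pure_of A A]. *)
Let R_tree A B : R (tree pure_of A B).
Proof.
have <- : cut pure_of (A + B) (A + B) - cut pure_of A A - cut pure_of B B
    = tree pure_of A B.
  have regroup (x y z t : T) : (x + y) + (z + t) - x - t = y + z.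
    by rewrite !addrA [LHS](ACl (1*5*(4*6)*2*3)) /= !subrr !add0r.
  by rewrite cutDl // !cutDr // regroup.
by apply: zspanB; [apply: zspanB|]; apply: zspan_mem; [exists (A + B)|exists A|exists B].
Qed.

Let uncut_eq a b : lie_eq a b -> R (uncut a - uncut b).
Proof.
elim=> {a b} /=.
- by move=> a; rewrite subrr; apply: zspan0.
- by move=> a b _ h; rewrite -opprB; apply: zspanN.
- by move=> a b c _ h1 _ h2; rewrite -[_ - _](subrKA (uncut b)); apply: zspanD.
- by move=> a a' b b' _ h1 _ h2; rewrite opprD addrACA; apply: zspanD.
- by move=> a a' _ h; rewrite -opprD; apply: zspanN.
- move=> a a' b b' /lie_of_eq -> _ /lie_of_eq -> _; rewrite subrr; exact: zspan0.
- by move=> *; rewrite addrA subrr; apply: zspan0.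
- by move=> a b; rewrite [uncut b + _]addrC subrr; apply: zspan0.
- by move=> *; rewrite add0r subrr; apply: zspan0.
- by move=> *; rewrite addNr subrr; apply: zspan0.
- by move=> *; rewrite addr0 subrr; apply: zspan0.
- by move=> *; rewrite lie_ofD cutDl // subrr; apply: zspan0.
- by move=> *; rewrite lie_ofD cutDr // subrr; apply: zspan0.
- by move=> a; rewrite subr0; apply: zspan_mem; exists (lie_of a).
move=> a b c; rewrite subr0 !lie_of_br.
set x := lie_of a; set y := lie_of b; set z := lie_of c.
(* The Jacobi relation goes to the tree with three branches. *)
have <- : tree pure_of x (lie_br y z) = cut pure_of x (lie_br y z) +
    (cut pure_of y (lie_br z x) + cut pure_of z (lie_br x y)).
  by rewrite /tree cut_br.
exact: R_tree.
Qed.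

Fixpoint bracket_term (s : tensor_term V (lie_part V k.+1)) : lie_term V :=
  match s with
  | TenPure v B => LieBr (LieGen v) (repr (lie_part_val B))
  | TenZero => LieZero
  | TenAdd s t => LieAdd (bracket_term s) (bracket_term t)
  | TenOpp s => LieOpp (bracket_term s)
  end.

Let ten_of s : T := \pi_(tensor V (lie_part V k.+1)) s.

Let ten_ofD s t : ten_of (TenAdd s t) = ten_of s + ten_of t.
Proof. by rewrite [RHS]ten_add_pi. Qed.

Let ten_ofN s : ten_of (TenOpp s) = - ten_of s.
Proof. by rewrite [RHS]ten_opp_pi. Qed.

Let lie_of_bracket_term s : lie_of (bracket_term s) = bracket_map (ten_of s).
Proof.
elim: s => [v B||s hs t ht|s hs] /=.
- rewrite lie_of_br [RHS]bracket_map_pure; congr lie_br.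
  exact: reprK.
- by rewrite [RHS](add_morph0 bracket_mapD).
- by rewrite lie_ofD hs ht ten_ofD bracket_mapD.
- by rewrite lie_ofN hs ten_ofN (add_morphN bracket_mapD).
Qed.

Let uncut_bracket_term s : uncut (bracket_term s) = ten_of s.
Proof.
elim: s => [v B||s hs t ht|s hs] //=.
- rewrite cut_gen // /pure_of; congr pure.
  by rewrite [lie_of _]reprK lie_part_of_id.
- by rewrite ten_ofD hs ht.
- by rewrite ten_ofN hs.
Qed.

(** A tensor in the kernel of the bracket comes from a relation in the free Lie
    algebra. The relation [lie_br A A = 0] gives [cut pure_of A A], and the
    Jacobi relation gives a tree, which is a polarization of these elements. *)
Lemma D_span (x : T) : bracket_map x = 0 ->
  zspan (fun y => exists A, y = cut pure_of A A) x.
Proof.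
elim/quotW: x => s; rewrite -/(ten_of s) -lie_of_bracket_term => s0.
have /uncut_eq : lie_eq (bracket_term s) LieZero by apply/free_lie_eqP.
by rewrite /= subr0 uncut_bracket_term.
Qed.

(** [pure_of] projects to degree $k+1$, while the tree rooted at one of its
    leaves has degree $p+q-1$. *)
Lemma cut_wrong_degree p q A B : lie_homog p A -> lie_homog q B ->
  (p + q)%N != k.+2 -> cut pure_of A B = 0.
Proof.
move=> hA; elim: hA q B => {p A} [v|p|p x y _ hx _ hy|p p' x y xp hx yp hy] q B Bq.
- move=> ne; rewrite cut_gen // /pure_of.
  have -> : lie_part_of k1 B = 0; last exact: add_morph0 (pureDr v).
  by apply: val_inj; rewrite /= (lie_comp_id _ Bq) /=; case: eqP => // e; lia.
- by rewrite cut0l.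
- by move=> ne; rewrite cutDl // cutNl // (hx _ _ Bq) // (hy _ _ Bq) // subrr.
- move=> ne; rewrite cut_br // (hx (p' + q)%N) ?(hy (q + p)%N) ?addr0 //.
  + exact: lie_homog_br.
  + by apply: contra ne => /eqP <-; apply/eqP; lia.
  + exact: lie_homog_br.
  + by apply: contra ne => /eqP <-; apply/eqP; lia.
Qed.
End KernelOfBracket.

(** * Classes in the lower central quotients *)

Section GradedClasses.
Variable T : finType.
Implicit Types (u v : free_group T) (a b : free_lie (free_ab T)).

Lemma gr_class_lcs q a u : gr_class q a u -> lcs q u.
Proof.
elim=> {q a u} [u|q|q a b u v _ hu _ hv|p q a b u v _ hu _ hv|q a u v _ hu uv].
- exact: lcsW.
- exact: lcs1.
- exact/lcsM/lcsV.
- exact: lcsR.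
- by rewrite -(mulVKg u v); apply: lcsM hu (lcs_le (leqnSn q) uv).
Qed.

Lemma gr_class_homog q a u : gr_class q a u -> lie_homog q a.
Proof.
elim=> {q a u} [u|q|q a b u v _ hu _ hv|p q a b u v _ hu _ hv|q a u v _ hu _] //.
- exact: lie_homog_gen.
- exact: lie_homog_zero.
- exact: lie_homog_sub.
- exact: lie_homog_br.
Qed.

Lemma lie_homog0 (V : zmodType) (x : free_lie V) : lie_homog 0 x -> x = 0.
Proof.
move=> hx; have /(_ 0%N _ hx) : forall q (x : free_lie V),
    lie_homog q x -> q = 0%N -> x = 0; last exact.
move=> q {hx}x; elim=> {q x} [//|//|q x y _ hx _ hy q0|p q x y _ hx _ hy /eqP].
  by rewrite hx // hy // subr0.
by rewrite addn_eq0 => /andP[/eqP p0 _]; rewrite hx // lie_br0l.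
Qed.

Lemma gr_classV q a u : gr_class q a u -> gr_class q (- a) (u^-1)%g.
Proof.
by rewrite -sub0r -(mul1g u^-1%g); apply: gr_class_sub (gr_class_zero _ _).
Qed.

Lemma gr_classM q a b u v :
  gr_class q a u -> gr_class q b v -> gr_class q (a + b) (u * v)%g.
Proof.
move=> hu /gr_classV hv; rewrite -(opprK b) -(invgK v).
exact: gr_class_sub.
Qed.

Lemma gr_class_deep q u : lcs q.+1 u -> gr_class q 0 u.
Proof.
move=> hu; apply: gr_class_mod (gr_class_zero _ q) _.
by rewrite /eq_mod_lcs invg1 mul1g.
Qed.

Lemma gr_classMr q a u v : gr_class q a u -> lcs q.+1 v -> gr_class q a (u * v)%g.
Proof. by move=> hu hv; apply: gr_class_mod hu _; rewrite /eq_mod_lcs mulKg. Qed.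

Lemma gr_classJ q a u w : gr_class q a u -> gr_class q a (u ^ w)%g.
Proof.
move=> hu; apply: gr_class_mod (hu) _; apply/eqm_sym/(@eqmJ _ _ q 1).
- by rewrite addn1.
- exact: gr_class_lcs hu.
- exact: lcsW.
Qed.
End GradedClasses.

Lemma gr_class_map (S T : finType) (h : free_group S -> free_group T)
    (p : free_ab S -> free_ab T) :
  {morph h : u v / (u * v)%g} -> {morph p : x y / x + y} ->
  (forall u, p (ab_class u) = ab_class (h u)) ->
  forall q a u, gr_class q a u -> gr_class q (lie_map p a) (h u).
Proof.
move=> hM pD ph q a u.
elim=> {q a u} [u|q|q a b u v _ hu _ hv|p' q a b u v _ hu _ hv|q a u v _ hu uv].
- by rewrite lie_map_gen // ph; apply: gr_class_gen.
- by rewrite (add_morph0 (lie_mapD pD)) (gmorph1 hM); apply: gr_class_zero.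
- by rewrite (add_morphB (lie_mapD pD)) hM (gmorphV hM); apply: gr_class_sub.
- by rewrite lie_map_br // (gmorphR hM); apply: gr_class_br.
- exact/(gr_class_mod hu)/eqm_morph.
Qed.

Lemma free_group_ind2 (T : choiceType) (P : free_group T -> Prop) :
  P 1%g -> (forall t, P (fgen t)) -> (forall u v, P u -> P v -> P (u * v)%g) ->
  (forall u, P u -> P (u^-1)%g) -> forall u, P u.
Proof.
move=> P1 Pg PM PV; apply: fg_ind => // t u Pu; apply: PM => //.
exact/PV/Pg.
Qed.

Section Endomorphisms.
Variable T : finType.
Local Notation F := (free_group T).
Local Notation V := (free_ab T).
Implicit Types (h : F -> F) (tau : V -> free_lie V).

(** [h] acts trivially modulo the $(k+1)$-st term of the lower central series,
    and [tau] is its image under the Johnson homomorphism. *)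
Definition has_johnson (k : nat) (h : F -> F) (tau : V -> free_lie V) : Prop :=
  forall u, gr_class k.+1 (tau (ab_class u)) (u^-1 * h u)%g.

(** The shifts by [h] form a crossed homomorphism, hence a homomorphism modulo
    the next term of the lower central series. *)
Lemma has_johnson_gen k h tau :
  {morph h : u v / (u * v)%g} -> {morph tau : x y / x + y} ->
  (forall t, gr_class k.+1 (tau (ab_gen t)) ((fgen t)^-1 * h (fgen t))%g) ->
  has_johnson k h tau.
Proof.
move=> hM tauD hg; elim/free_group_ind2 => [|t|u v hu hv|u hu].
- rewrite ab_class1 (add_morph0 tauD) (gmorph1 hM) mulVg; exact: gr_class_zero.
- by rewrite ab_class_gen.
- have -> : ((u * v)^-1 * h (u * v) = (u^-1 * h u) ^ v * (v^-1 * h v))%g.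
    by rewrite hM /conjg !gnorm.
  by rewrite ab_classM tauD; apply: gr_classM hv; apply: gr_classJ.
- have -> : ((u^-1)^-1 * h (u^-1) = ((u^-1 * h u)^-1) ^ u^-1)%g.
    by rewrite (gmorphV hM) /conjg !gnorm.
  by rewrite ab_classV (add_morphN tauD); apply/gr_classJ/gr_classV.
Qed.

Section Shift.
Variables (k : nat) (h : F -> F).
Hypothesis hM : {morph h : u v / (u * v)%g}.
Hypothesis k_gt0 : (0 < k)%N.
Hypothesis h_triv : forall u, lcs k.+1 (u^-1 * h u)%g.

Lemma shift_commg p q u v : (0 < p)%N -> (0 < q)%N -> lcs p u -> lcs q v ->
  lcs (p + k) (u^-1 * h u)%g -> lcs (q + k) (v^-1 * h v)%g ->
  eq_mod_lcs (p + q + k).+1 ((commg u v)^-1 * h (commg u v))%g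
    (commg (u^-1 * h u) v * commg u (v^-1 * h v))%g.
Proof.
move=> p0 q0 hu hv hu' hv'; rewrite (gmorphR hM).
rewrite -{1}(mulVKg u (h u)) -{1}(mulVKg v (h v)).
exact: commg_perturb.
Qed.

Let shiftM q u v : lcs q (u^-1 * h u)%g -> lcs q (v^-1 * h v)%g ->
  lcs q ((u * v)^-1 * h (u * v))%g.
Proof.
move=> hu hv; have -> : ((u * v)^-1 * h (u * v) =
    (u^-1 * h u) ^ v * (v^-1 * h v))%g by rewrite hM /conjg !gnorm.
exact/lcsM/hv/lcsJ.
Qed.

Let shiftV q u : lcs q (u^-1 * h u)%g -> lcs q ((u^-1)^-1 * h (u^-1))%g.
Proof.
move=> hu; have -> : ((u^-1)^-1 * h (u^-1) = ((u^-1 * h u)^-1) ^ u^-1)%g.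
  by rewrite (gmorphV hM) /conjg !gnorm.
exact/lcsJ/lcsV.
Qed.

Lemma shift_lcs q u : (0 < q)%N -> lcs q u -> lcs (q + k) (u^-1 * h u)%g.
Proof.
case: q => // q _; elim: q u => [|q IHq] u; first by rewrite add1n.
rewrite {1}/lcs /=; elim=> {u} [u [a aq [b ->]]||u v _ hu _ hv|u _ hu].
- have a' := IHq a aq; have b' := h_triv b.
  have := @shift_commg q.+1 1 a b isT isT aq (lcsW b) a' b' => /eqm_sym ce.
  rewrite -(mulVKg (commg (a^-1 * h a) b * commg a (b^-1 * h b))%g (_ * _)%g).
  apply: lcsM; last by apply: lcs_le ce; lia.
  apply: lcsM.
    by apply: lcs_le (lcsR a' (lcsW b)); lia.
  by apply: lcs_le (lcsR (aq : lcs q.+1 a) b'); lia.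
- by rewrite (gmorph1 hM) mulVg; apply: lcs1.
- exact: shiftM.
- exact: shiftV.
Qed.
End Shift.

(** Up to deeper terms the shift of a commutator of [u] and [v] is the product
    of the commutators of $u^{-1}h(u)$ with [v] and of [u] with $v^{-1}h(v)$,
    which is the Leibniz rule. *)
Lemma johnson_der k h tau q a u : {morph h : u v / (u * v)%g} ->
  {morph tau : x y / x + y} -> (0 < k)%N -> has_johnson k h tau ->
  gr_class q a u -> gr_class (q + k) (lie_der tau a) (u^-1 * h u)%g.
Proof.
move=> hM tauD k0 hj; have htriv v : lcs k.+1 (v^-1 * h v)%g.
  exact: gr_class_lcs (hj v).
have dD := lie_derD tauD; have shift := @shift_lcs k h hM k0 htriv.
elim=> {q a u} [u|q|q a b u v hu0 hu hv0 hv|p q a b u v hu0 hu hv0 hv|q a u v hu0 hu uv].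
- by rewrite lie_der_gen // add1n.
- by rewrite (add_morph0 dD) (gmorph1 hM) mulVg; apply: gr_class_zero.
- have -> : ((u * v^-1)^-1 * h (u * v^-1) =
      ((u^-1 * h u) * (v^-1 * h v)^-1) ^ (v^-1))%g.
    by rewrite hM (gmorphV hM) /conjg !gnorm.
  by rewrite (add_morphB dD); apply/gr_classJ/gr_class_sub.
(* A class of degree zero vanishes while its representative is arbitrary, so
   that these cases only hold because the bracket gains a degree. *)
- case: p => [|p] in hu0 hu *.
    rewrite (lie_homog0 (gr_class_homog hu0)) lie_br0l (add_morph0 dD) add0n.
    apply/gr_class_deep; rewrite -addSn; apply: shift => //.
    by rewrite -add1n; apply: lcsR (lcsW u) (gr_class_lcs hv0).
  case: q => [|q] in hv0 hv *.
    rewrite (lie_homog0 (gr_class_homog hv0)) lie_br0r (add_morph0 dD) addn0.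
    apply/gr_class_deep; rewrite -addSn; apply: shift => //.
    by rewrite -addn1; apply: lcsR (gr_class_lcs hu0) (lcsW v).
  rewrite lie_der_br //.
  have e := @shift_commg k h hM k0 p.+1 q.+1 u v isT isT (gr_class_lcs hu0)
    (gr_class_lcs hv0) (gr_class_lcs hu) (gr_class_lcs hv).
  apply: gr_class_mod (eqm_sym e); apply: gr_classM.
    by rewrite addnAC; apply: gr_class_br.
  by rewrite -addnA; apply: gr_class_br.
- rewrite -(mulVKg u v) hM.
  have -> : ((u * (u^-1 * v))^-1 * (h u * h (u^-1 * v)) =
    ((u^-1 * h u) ^ (u^-1 * v)) * ((u^-1 * v)^-1 * h (u^-1 * v)))%g.
    by rewrite /conjg !gnorm.
  apply: gr_classMr; first exact: gr_classJ.
  by rewrite -addSn; apply: shift.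
Qed.
End Endomorphisms.

(** * Johnson homomorphisms of mapping classes *)

Section MappingClasses.
Variable g : nat.
Local Notation F := (surface_group g).
Local Notation H := (H_surface g).
Implicit Types (h f : mapping_class g) (tau sigma : H -> free_lie H).

Definition mc_id : mapping_class g := @MappingClass g id
  (fun _ _ => erefl) (Bijective (fun=> erefl) (fun=> erefl)) erefl.

Definition mc_comp h f : mapping_class g.
refine (@MappingClass g (h \o f) _ _ _).
- by move=> u v; rewrite /= !mc_mul.
- exact: bij_comp (mc_bij h) (mc_bij f).
- by rewrite /= !mc_boundary.
Defined.

Lemma mc_inv_ex h : exists h' : mapping_class g, cancel h h' /\ cancel h' h.
Proof.
case: (mc_bij h) => h' hK h'K.
have h'M : {morph h' : u v / (u * v)%g}.
  by move=> u v; apply: (can_inj hK); rewrite mc_mul !h'K.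
have h'b : h' (boundary_word g) = boundary_word g.
  by rewrite -{1}(mc_boundary h) hK.
by exists (MappingClass h'M (Bijective h'K hK) h'b).
Qed.

Definition realized (k : nat) tau : Prop :=
  exists h, has_johnson k h tau.

Lemma realized_ext k tau tau' : tau =1 tau' -> realized k tau -> realized k tau'.
Proof. by move=> e [h hj]; exists h => u; rewrite -e. Qed.

Lemma johnson_ab k h tau u : (0 < k)%N -> has_johnson k h tau ->
  ab_class (h u) = ab_class u.
Proof.
move=> k0 hj; apply/esym/ab_classP.
by apply: lcs_le (gr_class_lcs (hj u)).
Qed.

Lemma realized0 k : realized k (fun=> 0).
Proof. by exists mc_id => u; rewrite /= mulVg; apply: gr_class_zero. Qed.

Lemma realizedD k tau sigma : (0 < k)%N -> realized k tau -> realized k sigma ->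
  realized k (fun t => tau t + sigma t).
Proof.
move=> k0 [h hj] [f fj]; exists (mc_comp h f) => u /=.
have hM := mc_mul h.
have -> : (u^-1 * h (f u) = u^-1 * h u * ((u^-1 * f u) *
    ((u^-1 * f u)^-1 * h (u^-1 * f u))))%g.
  by rewrite mulVKg hM (gmorphV hM) -!mulgA mulVKg.
apply: gr_classM (hj u) _; apply: gr_classMr (fj u) _.
apply: (@lcs_le _ _ (k.+1 + k)); first by lia.
by apply: shift_lcs => // [v|]; [exact: gr_class_lcs (hj v)|exact: gr_class_lcs (fj u)].
Qed.

Lemma realizedN k tau : (0 < k)%N -> realized k tau ->
  realized k (fun t => - tau t).
Proof.
move=> k0 [h hj]; have [h' [hK h'K]] := mc_inv_ex h; exists h' => u.
have -> : (u^-1 * h' u = ((h' u)^-1 * h (h' u))^-1)%g by rewrite h'K invgM invgK.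
rewrite -{1}(h'K u) (johnson_ab _ k0 hj).
exact/gr_classV/hj.
Qed.

(** With $A = v^{-1}h(v)$ and $B = v^{-1}f(v)$, the commutator of [h] and [f]
    moves $u = fh(v)$ by $(A^{-1}f(A))^{-1}\,[A,B]\,(B^{-1}h(B))$. The outer
    factors are given by the two derivations, and the middle one is a degree
    deeper. *)
Lemma realized_comm k l tau sigma : (0 < k)%N -> (0 < l)%N ->
  {morph tau : x y / x + y} -> {morph sigma : x y / x + y} ->
  realized k tau -> realized l sigma ->
  realized (k + l) (fun t => lie_der tau (sigma t) - lie_der sigma (tau t)).
Proof.
move=> k0 l0 tauD sigmaD [h hj] [f fj].
have [h' [hK h'K]] := mc_inv_ex h; have [f' [fK f'K]] := mc_inv_ex f.
exists (mc_comp (mc_comp h f) (mc_comp h' f')) => u /=.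
set v := h' (f' u); have uE : u = f (h v) by rewrite /v h'K f'K.
have -> : ab_class u = ab_class v.
  by rewrite uE (johnson_ab _ l0 fj) (johnson_ab _ k0 hj).
have hM := mc_mul h; have fM := mc_mul f.
pose A := (v^-1 * h v)%g; pose B := (v^-1 * f v)%g.
have -> : (u^-1 * h (f v) = (A^-1 * f A)^-1 * (commg A B * (B^-1 * h B)))%g.
  rewrite uE -(mulVKg v (h v)) -(mulVKg v (f v)) -/A -/B fM hM.
  rewrite -{1}(mulVKg v (h v)) -{1}(mulVKg v (f v)) -/A -/B.
  by rewrite /commg /conjg !gnorm.
rewrite addrC; apply: gr_classM.
  exact/gr_classV/(johnson_der fM sigmaD l0 fj (hj v)).
rewrite -[lie_der _ _]add0r; apply: gr_classM.
  apply: gr_class_deep; apply: lcs_le (lcsR (gr_class_lcs (hj v)) (gr_class_lcs (fj v))).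
  by lia.
rewrite addnC; exact: (johnson_der hM tauD k0 hj (fj v)).
Qed.

Lemma realized_conj k tau tau' f (p : H -> H) :
  {morph p : x y / x + y} -> (forall u, ab_class (f u) = p (ab_class u)) ->
  (forall t, tau' (p t) = lie_map p (tau t)) ->
  realized k tau -> realized k tau'.
Proof.
move=> pD fp tau'E [h hj]; have [f' [fK f'K]] := mc_inv_ex f.
exists (mc_comp f (mc_comp h f')) => u /=.
set v := f' u; have uE : u = f v by rewrite f'K.
have fM := mc_mul f; rewrite uE fp tau'E -(gmorphV fM) -fM.
exact: gr_class_map.
Qed.
End MappingClasses.

(** * Some explicit mapping classes *)

Lemma ab_classJ (T : finType) (u v : free_group T) :
  ab_class (u ^ v)%g = ab_class u.
Proof. by rewrite !ab_classM ab_classV addrC addrK. Qed.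

Lemma ab_class_comm (T : finType) (u v : free_group T) :
  ab_class (commg u v) = 0.
Proof. by rewrite ab_classM ab_classV ab_classJ addNr. Qed.

Section Surface.
Variable g : nat.
Local Notation F := (surface_group g).
Local Notation H := (H_surface g).
Implicit Types (a b c i j : 'I_g) (u v : F) (t : H).

Definition Xh j : H := ab_gen (inl j).
Definition Yh j : H := ab_gen (inr j).
Definition handle j : F := commg (xg j) (yg j).

Lemma prod_adjacent (G : groupType) (A B : 'I_g -> G) a b : b = a.+1 :> nat ->
  (forall j, j != a -> j != b -> A j = B j) -> (A a * A b = B a * B b)%g ->
  (\prod_(j < g) A j = \prod_(j < g) B j)%g.
Proof.
move=> ba AB ABab; pose ext (C : 'I_g -> G) (i : nat) := oapp C 1%g (insub i).
have extE (C : 'I_g -> G) : (\prod_(j < g) C j = \prod_(0 <= i < g) ext C i)%g.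
  by rewrite big_mkord; apply: eq_bigr => j _; rewrite /ext valK.
rewrite !extE.
have ag := ltn_ord a; have bg := ltn_ord b.
have split3 (C : nat -> G) : (\prod_(0 <= i < g) C i =
    \prod_(0 <= i < a) C i * ((C a * C b) * \prod_(b.+1 <= i < g) C i))%g.
  rewrite (@big_cat_nat _ _ _ a) //=; last exact: ltnW.
  by rewrite (@big_ltn _ _ _ a) // -ba (@big_ltn _ _ _ b) // !mulgA.
rewrite !split3; congr (_ * (_ * _))%g.
- apply: eq_big_nat => i /andP[_ ia]; rewrite /ext; case: insubP => //= j _ ji.
  by apply: AB; rewrite -val_eqE /= ji; lia.
- by rewrite /ext !valK.
- apply: eq_big_nat => i /andP[ib _]; rewrite /ext; case: insubP => //= j _ ji.
  by apply: AB; rewrite -val_eqE /= ji; lia.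
Qed.

Section Endomorphism.
Variables phi psi : 'I_g + 'I_g -> F.
Hypothesis phiK : forall s, fg_ext phi (psi s) = fgen s.
Hypothesis psiK : forall s, fg_ext psi (phi s) = fgen s.

Lemma fg_extK (rho sigma : 'I_g + 'I_g -> F) :
  (forall s, fg_ext rho (sigma s) = fgen s) -> 
  cancel (fg_ext sigma) (fg_ext rho).
Proof.
move=> e; elim/free_group_ind2 => [|t|u v hu hv|u hu].
- by rewrite !fg_ext1.
- by rewrite fg_ext_gen e.
- by rewrite !fg_extM hu hv.
- by rewrite !fg_extV hu.
Qed.

Lemma mapping_class_of : fg_ext phi (boundary_word g) = boundary_word g ->
  exists h : mapping_class g, forall s, h (fgen s) = phi s.
Proof.
move=> hb; exists (MappingClass (@fg_extM _ _ phi)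
  (Bijective (fg_extK psiK) (fg_extK phiK)) hb) => s.
exact: fg_ext_gen.
Qed.

Lemma mapping_class_of_pair a b : b = a.+1 :> nat ->
  (forall j, j != a -> j != b -> phi (inl j) = xg j /\ phi (inr j) = yg j) ->
  (commg (phi (inl a)) (phi (inr a)) * commg (phi (inl b)) (phi (inr b)) =
    handle a * handle b)%g ->
  exists h : mapping_class g, forall s, h (fgen s) = phi s.
Proof.
move=> ba hne hab; apply: mapping_class_of.
have hR j : fg_ext phi (handle j) = commg (phi (inl j)) (phi (inr j)).
  by rewrite (gmorphR (@fg_extM _ _ phi)) !fg_ext_gen.
rewrite /boundary_word (big_morph _ (@fg_extM _ _ phi) (@fg_ext1 _ _ phi)).
apply: (prod_adjacent ba) => [j ja jb|]; last by rewrite -!/(handle _) !hR.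
by rewrite -/(handle _) hR; have [-> ->] := hne j ja jb.
Qed.
End Endomorphism.

Definition on_pair a b (xa ya xb yb : F) (s : 'I_g + 'I_g) : F :=
  match s with
  | inl j => if j == a then xa else if j == b then xb else xg j
  | inr j => if j == a then ya else if j == b then yb else yg j
  end.

Section OnPair.
Variables (a b : 'I_g).
Hypothesis ab : a != b.
Let ba : (b == a) = false. Proof. by rewrite eq_sym (negPf ab). Qed.
Variables xa ya xb yb : F.
Let phi := on_pair a b xa ya xb yb.

Lemma on_pair_xa : fg_ext phi (xg a) = xa.
Proof. by rewrite fg_ext_gen /phi /= eqxx. Qed.
Lemma on_pair_ya : fg_ext phi (yg a) = ya.
Proof. by rewrite fg_ext_gen /phi /= eqxx. Qed.
Lemma on_pair_xb : fg_ext phi (xg b) = xb.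
Proof. by rewrite fg_ext_gen /phi /= ba eqxx. Qed.
Lemma on_pair_yb : fg_ext phi (yg b) = yb.
Proof. by rewrite fg_ext_gen /phi /= ba eqxx. Qed.
End OnPair.
Definition on_pairE := (on_pair_xa, on_pair_ya, on_pair_xb, on_pair_yb).

Lemma mapping_class_on_pair a b xa ya xb yb xa' ya' xb' yb' : b = a.+1 :> nat ->
  let phi := fg_ext (on_pair a b xa ya xb yb) in
  let psi := fg_ext (on_pair a b xa' ya' xb' yb') in
  [/\ phi xa' = xg a, phi ya' = yg a, phi xb' = xg b & phi yb' = yg b] ->
  [/\ psi xa = xg a, psi ya = yg a, psi xb = xg b & psi yb = yg b] ->
  (commg xa ya * commg xb yb = handle a * handle b)%g ->
  exists h : mapping_class g, forall s, h (fgen s) = on_pair a b xa ya xb yb s.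
Proof.
move=> ba phi psi [p1 p2 p3 p4] [q1 q2 q3 q4] hb.
have ab : (b == a) = false by rewrite -val_eqE /=; lia.
apply: (mapping_class_of_pair (psi := on_pair a b xa' ya' xb' yb')) ba _ _.
- case=> j /=; case: eqP => [->//|/eqP ja]; case: eqP => [->//|/eqP jb].
    by rewrite fg_ext_gen /= (negPf ja) (negPf jb).
  by rewrite fg_ext_gen /= (negPf ja) (negPf jb).
- case=> j /=; case: eqP => [->//|/eqP ja]; case: eqP => [->//|/eqP jb].
    by rewrite fg_ext_gen /= (negPf ja) (negPf jb).
  by rewrite fg_ext_gen /= (negPf ja) (negPf jb).
- by move=> j ja jb; rewrite /= (negPf ja) (negPf jb).
- by rewrite /= !eqxx ab.
Qed.

Lemma ab_class_morph (h : F -> F) (p : H -> H) :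
  {morph h : u v / (u * v)%g} -> {morph p : x y / x + y} ->
  (forall s, ab_class (h (fgen s)) = p (ab_gen s)) ->
  forall u, ab_class (h u) = p (ab_class u).
Proof.
move=> hM pD hg; elim/free_group_ind2 => [|s|u v hu hv|u hu].
- by rewrite (gmorph1 hM) !ab_class1 (add_morph0 pD).
- by rewrite ab_class_gen.
- by rewrite hM !ab_classM pD hu hv.
- by rewrite (gmorphV hM) !ab_classV (add_morphN pD) hu.
Qed.

(** * The intersection form *)

Lemma omegaDl t t' (v : H) : omega (t + t') v = omega t v + omega t' v.
Proof. by rewrite -big_split; apply: eq_bigr => j _; rewrite !ffunE /=; ring. Qed.

Lemma omegaC t t' : omega t t' = - omega t' t.
Proof. by rewrite -sumrN; apply: eq_bigr => j _; ring. Qed.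

Lemma omegaDr t : {morph omega t : v w / v + w}.
Proof. by move=> v w; rewrite omegaC omegaDl opprD -!(omegaC t). Qed.

Lemma omega_gen s t : omega (ab_gen s) t =
  match s with inl j => t (inr j) | inr j => - t (inl j) end.
Proof.
case: s => j; rewrite /omega (bigD1 j) //= big1 ?addr0 => [|i ij].
- by rewrite !ffunE eqxx /=; ring.
- rewrite !ffunE /= (_ : inl i == inl j = false) ?mul0r ?subr0 //.
  by apply/negP=> /eqP[/eqP]; rewrite (negPf ij).
- by rewrite !ffunE eqxx /=; ring.
- rewrite !ffunE /= (_ : inr i == inr j = false) ?mul0r ?subr0 //.
  by apply/negP=> /eqP[/eqP]; rewrite (negPf ij).
Qed.

Lemma ab_gen_xx i j : ab_gen (inl i : 'I_g + 'I_g) (inl j) = (j == i)%:R.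
Proof. by rewrite ffunE. Qed.
Lemma ab_gen_yy i j : ab_gen (inr i : 'I_g + 'I_g) (inr j) = (j == i)%:R.
Proof. by rewrite ffunE. Qed.
Lemma ab_gen_xy i j : ab_gen (inl i : 'I_g + 'I_g) (inr j) = 0.
Proof. by rewrite ffunE. Qed.
Lemma ab_gen_yx i j : ab_gen (inr i : 'I_g + 'I_g) (inl j) = 0.
Proof. by rewrite ffunE. Qed.

Lemma omega_xx i j : omega (Xh i) (Xh j) = 0.
Proof. by rewrite omega_gen ab_gen_xy. Qed.
Lemma omega_yy i j : omega (Yh i) (Yh j) = 0.
Proof. by rewrite omega_gen ab_gen_yx oppr0. Qed.
Lemma omega_xy i j : omega (Xh i) (Yh j) = if i == j then 1 else 0.
Proof. by rewrite omega_gen ab_gen_yy; case: eqP. Qed.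
Lemma omega_yx i j : omega (Yh i) (Xh j) = if i == j then -1 else 0.
Proof. by rewrite omega_gen ab_gen_xx; case: eqP => //=; rewrite oppr0. Qed.
Definition omegaE := (omega_xx, omega_yy, omega_xy, omega_yx).
End Surface.

(** * Trees realized by mapping classes *)

Section RealizedTrees.
Variable g : nat.
Local Notation F := (surface_group g).
Local Notation H := (H_surface g).
Local Notation LH := (free_lie H).
Implicit Types (a b c i j : 'I_g) (u : F) (t v : H) (A B : LH).

Definition contract t (v : H) (B : LH) : LH := B *~ omega t v.

Lemma contractDl t (v w : H) B :
  contract t (v + w) B = contract t v B + contract t w B.
Proof. by rewrite /contract omegaDr mulrzDr. Qed.

Lemma contractDr t (v : H) : {morph contract t v : B C / B + C}.
Proof. by move=> B C; rewrite /contract mulrzDl. Qed.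

(** The derivation of degree $\deg A + \deg B - 2$ that corresponds to the
    tree joining the roots of [A] and [B]. *)
Definition tree_der A B t : LH := tree (contract t) A B.

Let cDl := contractDl.
Let cDr := contractDr.

Lemma cut_contractD A B t t' :
  cut (contract (t + t')) A B = cut (contract t) A B + cut (contract t') A B.
Proof.
elim/free_lie_ind: A B => [v||A A' hA hA'|A hA|A A' hA hA'] B.
- by rewrite !cut_gen // /contract omegaDl mulrzDr.
- by rewrite !cut0l // addr0.
- by rewrite !cutDl // hA hA' addrACA.
- by rewrite !cutNl // hA opprD.
- by rewrite !cut_br // hA hA' addrACA.
Qed.

Lemma tree_derD A B : {morph tree_der A B : t t' / t + t'}.
Proof. by move=> t t'; rewrite /tree_der /tree !cut_contractD addrACA. Qed.

Definition realized_tree k A B : Prop := realized k (tree_der A B).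

Lemma realized_treeC k A B : realized_tree k A B -> realized_tree k B A.
Proof. by apply: realized_ext => t; apply: treeC. Qed.

Lemma realized_treeDl k A A' B : (0 < k)%N ->
  realized_tree k A B -> realized_tree k A' B -> realized_tree k (A + A') B.
Proof.
move=> k0 h h'; apply: realized_ext (realizedD k0 h h') => t.
by rewrite /tree_der treeDl.
Qed.

Lemma realized_treeNl k A B : (0 < k)%N ->
  realized_tree k A B -> realized_tree k (- A) B.
Proof.
move=> k0 h; apply: realized_ext (realizedN k0 h) => t.
by rewrite /tree_der treeNl.
Qed.

Lemma realized_tree0l k B : realized_tree k 0 B.
Proof.
by apply: realized_ext (realized0 _ k) => t; rewrite /tree_der tree0l.
Qed.

Lemma realized_slide k A A' B :
  realized_tree k (lie_br A A') B <-> realized_tree k A (lie_br A' B).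
Proof.
by split; apply: realized_ext => t; rewrite /tree_der tree_slide.
Qed.

Definition isometry (p : H -> H) : Prop :=
  {morph p : x y / x + y} /\ forall x y, omega (p x) (p y) = omega x y.

Definition homology_action (p : H -> H) : Prop :=
  isometry p /\ exists f : mapping_class g,
    forall u, ab_class (f u) = p (ab_class u).

(** Conjugation by a mapping class moves the leaves of the tree. *)
Lemma realized_tree_conj k A B p : homology_action p ->
  realized_tree k A B -> realized_tree k (lie_map p A) (lie_map p B).
Proof.
move=> [[pD pom] [f fp]]; apply: (realized_conj pD fp) => t.
apply/esym/(tree_natural (cDl t) (cDr t) (cDl _) (cDr _) pD (lie_mapD pD)) => v C.
by rewrite /contract pom (add_morphMz (lie_mapD pD)).
Qed.

Definition realized_tripod (p q r : H) : Prop :=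
  realized_tree 1 (lie_gen p) (lie_br (lie_gen q) (lie_gen r)).

(** The tripod can be cut at any of its three edges. *)
Lemma realized_tripod_cycle p q r :
  realized_tripod p q r -> realized_tripod r p q.
Proof.
by move/realized_slide/realized_treeC.
Qed.

Lemma realized_tripod_swap p q r :
  realized_tripod p q r -> realized_tripod p r q.
Proof.
rewrite /realized_tripod (lie_brC (lie_gen r)).
by move/realized_treeC/(realized_treeNl (ltnSn 0))/realized_treeC.
Qed.

Lemma realized_tripodD p p' q r : realized_tripod p q r ->
  realized_tripod p' q r -> realized_tripod (p + p') q r.
Proof. by rewrite /realized_tripod lie_genD; apply: realized_treeDl. Qed.

Lemma realized_tripodN p q r : realized_tripod p q r -> realized_tripod (- p) q r.
Proof. by rewrite /realized_tripod lie_genN; apply: realized_treeNl. Qed.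

Lemma realized_tripod_xx p r : realized_tripod p p r.
Proof.
apply/realized_tripod_cycle/realized_tripod_cycle.
by rewrite /realized_tripod lie_brxx; apply/realized_treeC/realized_tree0l.
Qed.

Lemma realized_tripod_conj f p q r : homology_action f ->
  realized_tripod p q r -> realized_tripod (f p) (f q) (f r).
Proof.
move=> hf; have [[fD _] _] := hf; move/(realized_tree_conj hf).
by rewrite lie_map_br // !lie_map_gen.
Qed.

Definition transvection (v t : H) : H := t - v *~ omega t v.

Lemma transvection_isometry v : isometry (transvection v).
Proof.
have tD : {morph transvection v : x y / x + y}.
  by move=> x y; rewrite /transvection omegaDl mulrzDr opprD addrACA.
split=> // x y; rewrite /transvection.
have oB (u s w : H) (m : int) : omega (u - s *~ m) w = omega u w - omega s w * m.
  rewrite omegaDl (add_morphN (fun s s' : H => omegaDl s s' w)).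
  by rewrite (add_morphMz (fun s s' : H => omegaDl s s' w)) -mulrzr intz.
have oBr (u s w : H) (m : int) : omega w (u - s *~ m) = omega w u - omega w s * m.
  by rewrite omegaC oB (omegaC u) (omegaC s); ring.
rewrite oB !oBr (omegaC v y).
have -> : omega v v = 0 by have := omegaC v v; lia.
by ring.
Qed.

(** If [v] is orthogonal to [q] and [r], the transvection along [v] only
    moves the leaf [p], and the difference of the two tripods has the leaf
    [v] in place of [p], up to sign. *)
Lemma realized_tripod_transvection v p q r :
  homology_action (transvection v) -> omega q v = 0 -> omega r v = 0 ->
  omega p v = 1 \/ omega p v = -1 ->
  realized_tripod p q r -> realized_tripod v q r.
Proof.
move=> hv qv rv pv h; have := realized_tripod_conj hv h.
rewrite /transvection qv rv !mulr0z !subr0.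
move/realized_tripodD/(_ (realized_tripodN h)); rewrite addrAC subrr add0r.
by case: pv => ->; rewrite ?mulrN1z ?mulr1z ?opprK // => /realized_tripodN; rewrite opprK.
Qed.

End RealizedTrees.

(** * Tripods with prescribed leaves *)

Section Generators.
Variable g : nat.
Local Notation F := (surface_group g).
Local Notation H := (H_surface g).
Local Notation LH := (free_lie H).
Implicit Types (a b c i j : 'I_g) (u : F) (t v : H) (A B : LH).

Lemma homology_action_gen (h : mapping_class g) (p : H -> H) : isometry p ->
  (forall s, ab_class (h (fgen s)) = p (ab_gen s)) -> homology_action p.
Proof.
by move=> [pD pom] hp; split=> //; exists h; apply: ab_class_morph (mc_mul h) pD hp.
Qed.

Lemma homology_action_comp (p q : H -> H) :
  homology_action p -> homology_action q -> homology_action (p \o q).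
Proof.
move=> [[pD pom] [f fp]] [[qD qom] [h hq]]; split; first split.
- by move=> x y; rewrite /= qD pD.
- by move=> x y; rewrite /= pom qom.
- by exists (mc_comp f h) => u; rewrite /= fp hq.
Qed.

Definition permH (s : {perm 'I_g}) t : H :=
  [ffun x => t (match x with inl j => inl (s j) | inr j => inr (s j) end)].

Lemma permH_isometry s : isometry (permH s).
Proof.
split=> [x y|x y]; first by apply/ffunP=> z; rewrite !ffunE.
rewrite [RHS](reindex_inj (@perm_inj _ s)) /=.
by apply: eq_bigr => j _; rewrite !ffunE.
Qed.

Lemma permH_M s s' : permH (s * s')%g =1 permH s \o permH s'.
Proof.
by move=> t; apply/ffunP=> -[j|j]; rewrite !ffunE /= permM.
Qed.

Lemma permH_x s i : permH s (Xh (s i)) = Xh i.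
Proof.
apply/ffunP=> -[j|j]; rewrite !ffunE //=; congr ((_ : bool)%:R).
by apply/eqP/eqP => [[/perm_inj->]//|[->]].
Qed.

Lemma permH_y s i : permH s (Yh (s i)) = Yh i.
Proof.
apply/ffunP=> -[j|j]; rewrite !ffunE //=; congr ((_ : bool)%:R).
by apply/eqP/eqP => [[/perm_inj->]//|[->]].
Qed.

(** A transposition is shortened by conjugating it with an adjacent one. *)
Lemma tperm_ind (P : {perm 'I_g} -> Prop) :
  (forall s s', P s -> P s' -> P (s * s')%g) ->
  (forall a b, b = a.+1 :> nat -> P (tperm a b)) ->
  forall a b, a != b -> P (tperm a b).
Proof.
move=> PM Padj a b; wlog ab : a b / (a < b)%N => [h ne|_].
  case: (ltngtP a b) (ne) => [ab _|ba _|/val_inj->]; last by rewrite eqxx.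
    exact: h.
  by rewrite tpermC; apply: h => //; rewrite eq_sym.
have [n nE] := ubnP (b - a); elim: n => // n IHn in a b ab nE *.
have [/eqP ba|ba] := boolP (b == a.+1 :> nat); first exact: Padj.
have b1g : (b.-1 < g)%N by have := ltn_ord b; lia.
pose b1 : 'I_g := Ordinal b1g.
have bb1 : b = b1.+1 :> nat by rewrite /=; lia.
have Pa : P (tperm a b1) by apply: IHn => /=; lia.
have <- : ((tperm a b1) ^ (tperm b1 b))%g = tperm a b.
  by rewrite tpermJ tpermL tpermD // -val_eqE /=; lia.
rewrite conjgE tpermV.
by apply: (PM _ _ _ (PM _ _ Pa _)); apply: Padj.
Qed.

(** Two transpositions carry the pair $(0,1)$ to any pair of distinct indices. *)
Lemma adjacent_pair_ind (P : 'I_g -> 'I_g -> Prop) :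
  (forall i j a b, i != j -> P a b -> P (tperm i j a) (tperm i j b)) ->
  (forall a b, b = a.+1 :> nat -> P a b) -> forall a b, a != b -> P a b.
Proof.
move=> Ptp Padj a b ab.
have Ptp' i j c d : P c d -> P (tperm i j c) (tperm i j d).
  by have [->|ij] := eqVneq i j; [rewrite !tperm1 !perm1 | exact: Ptp].
have g2 : (1 < g)%N.
  have := ltn_ord a; have := ltn_ord b.
  by move: ab; rewrite -val_eqE /=; case: (g) a b => [|[|n]] // a b; lia.
pose z : 'I_g := Ordinal (ltnW g2); pose o : 'I_g := Ordinal g2.
have := Padj z o erefl; move/(Ptp' z a); rewrite tpermL => P1.
have ao : tperm z a o != a.
  by rewrite -{2}(tpermL z a) (inj_eq perm_inj).
by have := Ptp' (tperm z a o) b _ _ P1; rewrite tpermL tpermD // eq_sym.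
Qed.

(** The second handle is pulled in front of the first one, which conjugates it
    by the boundary curve of the first. *)
Lemma swap_adjacent a b : b = a.+1 :> nat ->
  homology_action (permH (tperm a b)).
Proof.
move=> ba; have ab : a != b by rewrite -val_eqE /=; lia.
pose ca := handle a; pose cb := handle b.
have [] := @mapping_class_on_pair g a b
  (xg b ^ ca^-1)%g (yg b ^ ca^-1)%g (xg a) (yg a)
  (xg b) (yg b) (xg a ^ cb)%g (yg a ^ cb)%g ba.
- set phi := fg_ext _; have phiM : {morph phi : u v / (u * v)%g} := fg_extM _.
  have phiJ := gmorphR phiM; have phiV := gmorphV phiM.
  rewrite /conjg /cb /handle !(phiM, phiV, phiJ) /phi !on_pairE //.
  by split=> //; rewrite -/(handle a) -/ca -?conjgE -?conjRg /conjg ?gnorm.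
- set psi := fg_ext _; have psiM : {morph psi : u v / (u * v)%g} := fg_extM _.
  have psiJ := gmorphR psiM; have psiV := gmorphV psiM.
  rewrite /conjg /ca /handle !(psiM, psiV, psiJ) /psi !on_pairE //.
  by split=> //; rewrite -/(handle b) -/cb /conjg ?gnorm.
- rewrite -conjRg -!/(handle _) -/ca -/cb.
  by rewrite /conjg !gnorm.
move=> h hE; apply: (homology_action_gen (h := h)) (permH_isometry _) _.
have pXa : permH (tperm a b) (Xh a) = Xh b by have := permH_x (tperm a b) b; rewrite tpermR.
have pXb : permH (tperm a b) (Xh b) = Xh a by have := permH_x (tperm a b) a; rewrite tpermL.
have pYa : permH (tperm a b) (Yh a) = Yh b by have := permH_y (tperm a b) b; rewrite tpermR.
have pYb : permH (tperm a b) (Yh b) = Yh a by have := permH_y (tperm a b) a; rewrite tpermL.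
have tpj j : j != a -> j != b -> tperm a b j = j.
  by move=> ja jb; rewrite tpermD // eq_sym.
case=> j; rewrite hE /=; case: (eqVneq j a) => [->|ja].
- by rewrite ab_classJ ab_class_gen -/(Xh b) -/(Xh a) pXa.
- case: (eqVneq j b) => [->|jb]; rewrite ab_class_gen ?pXb //.
  by have := permH_x (tperm a b) j; rewrite tpj // => ->.
- by rewrite ab_classJ ab_class_gen -/(Yh b) -/(Yh a) pYa.
- case: (eqVneq j b) => [->|jb]; rewrite ab_class_gen ?pYb //.
  by have := permH_y (tperm a b) j; rewrite tpj // => ->.
Qed.

Lemma tperm_action i j : i != j -> homology_action (permH (tperm i j)).
Proof.
move: i j; apply: (tperm_ind (P := fun s => homology_action (permH s))).
  move=> s s' hs hs'; rewrite (funext (permH_M s s')).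
  exact: homology_action_comp.
exact: swap_adjacent.
Qed.

Lemma permH_tperm_x i j c : permH (tperm i j) (Xh c) = Xh (tperm i j c).
Proof. by have := permH_x (tperm i j) (tperm i j c); rewrite tpermK. Qed.

Lemma permH_tperm_y i j c : permH (tperm i j) (Yh c) = Yh (tperm i j c).
Proof. by have := permH_y (tperm i j) (tperm i j c); rewrite tpermK. Qed.

(** The Dehn twist about the meridian [xg a]. *)
Lemma transvection_x a : homology_action (transvection (Xh a)).
Proof.
pose phi s := match s with
  | inl j => xg j | inr j => if j == a then (xg a * yg a)%g else yg j end.
pose psi s := match s with
  | inl j => xg j | inr j => if j == a then ((xg a)^-1 * yg a)%g else yg j end.
have [|||h hE] := @mapping_class_of g phi psi.
- case=> j; rewrite /psi; first by rewrite fg_ext_gen.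
  case: eqP => [->|/eqP ja]; last by rewrite fg_ext_gen /phi (negPf ja).
  by rewrite fg_extM fg_extV !fg_ext_gen /phi eqxx mulKg.
- case=> j; rewrite /phi; first by rewrite fg_ext_gen.
  case: eqP => [->|/eqP ja]; last by rewrite fg_ext_gen /psi (negPf ja).
  by rewrite fg_extM !fg_ext_gen /psi eqxx mulVKg.
- rewrite /boundary_word (big_morph _ (@fg_extM _ _ phi) (@fg_ext1 _ _ phi)).
  apply: eq_bigr => j _; rewrite (gmorphR (@fg_extM _ _ phi)) !fg_ext_gen /phi.
  by case: eqP => // ->; rewrite /commg /conjg !gnorm.
apply: (homology_action_gen (h := h)) (transvection_isometry _) _.
case=> j; rewrite hE /phi /transvection -/(Xh j) -/(Yh j).
  by rewrite omega_xx mulr0z subr0 ab_class_gen.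
rewrite omega_yx; case: eqP => [->|_]; last by rewrite mulr0z subr0 ab_class_gen.
by rewrite (@ab_classM ('I_g + 'I_g)%type) !ab_class_gen mulrN1z opprK addrC.
Qed.

(** The Dehn twist about a curve that runs once around the longitudes of two
    neighbouring handles. *)
Lemma transvection_yy a b : b = a.+1 :> nat ->
  homology_action (transvection (Yh a - Yh b)).
Proof.
move=> ba; have ab : a != b by rewrite -val_eqE /=; lia.
pose z : F := ((xg b)^-1 * (yg b)^-1 * xg b)%g.
pose c : F := (yg a * z)%g.
have [] := @mapping_class_on_pair g a b
  (c^-1 * xg a)%g (yg a ^ c)%g (xg b * c)%g (yg b)
  (c * xg a)%g (yg a ^ c^-1)%g (xg b * c^-1)%g (yg b) ba.
- set phi := fg_ext _; have phiM : {morph phi : u v / (u * v)%g} := fg_extM _.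
  have phiJ := gmorphJ phiM; have phiV := gmorphV phiM.
  have phic : phi c = c.
    rewrite /c /z !(phiM, phiV) /phi !on_pairE // -/phi.
    by rewrite /conjg /c /z !gnorm.
  split; rewrite ?phiJ; last by rewrite /phi !on_pairE.
  + by rewrite phiM phic /phi !on_pairE // mulVKg.
  + by rewrite phiV phic /phi !on_pairE // conjgK.
  + by rewrite phiM phiV phic /phi !on_pairE // mulgK.
- set psi := fg_ext _; have psiM : {morph psi : u v / (u * v)%g} := fg_extM _.
  have psiJ := gmorphJ psiM; have psiV := gmorphV psiM.
  have psic : psi c = c.
    rewrite /c /z !(psiM, psiV) /psi !on_pairE // -/psi.
    by rewrite /conjg /c /z !gnorm.
  split; rewrite ?psiJ; last by rewrite /psi !on_pairE.
  + by rewrite psiM psiV psic /psi !on_pairE // mulKg.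
  + by rewrite psic /psi !on_pairE // conjgKV.
  + by rewrite psiM psic /psi !on_pairE // mulgVK.
- by rewrite /handle /commg /conjg /c /z !gnorm.
move=> h hE; apply: (homology_action_gen (h := h)) (transvection_isometry _) _.
have abc : ab_class c = Yh a - Yh b.
  rewrite /c /z !ab_classM !ab_classV !ab_class_gen -/(Xh b) -/(Yh a) -/(Yh b).
  by rewrite addrAC addNr sub0r.
have om t : omega t (Yh a - Yh b) = omega t (Yh a) - omega t (Yh b).
  by rewrite (add_morphB (omegaDr t)).
case=> j; rewrite hE /= /transvection -/(Xh j) -/(Yh j); last first.
  have -> : omega (Yh j) (Yh a - Yh b) = 0 by rewrite om !omega_yy.
  rewrite mulr0z subr0.
  by case: eqP => [->|_]; [|case: eqP => [->|_]]; rewrite ?ab_classJ ab_class_gen.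
have := om (Xh j); rewrite !omega_xy; case: eqP => [->|_].
  rewrite (negPf ab) => ->.
  by rewrite mulr1z ab_classM ab_classV abc ab_class_gen addrC.
case: eqP => [->|_] ->; last by rewrite mulr0z subr0 ab_class_gen.
by rewrite mulrN1z opprK ab_classM abc ab_class_gen.
Qed.

Lemma tripod_der (p q r t : H) : tree_der (lie_gen p) (lie_br (lie_gen q) (lie_gen r)) t =
  lie_br (lie_gen q) (lie_gen r) *~ omega t p +
  (lie_br (lie_gen r) (lie_gen p) *~ omega t q +
   lie_br (lie_gen p) (lie_gen q) *~ omega t r).
Proof.
have cDl := @contractDl g t; have cDr := @contractDr g t.
by rewrite /tree_der /tree cut_br // !cut_gen.
Qed.

(** The handle [a] is pushed once around the longitude of the handle [b], so
    that it is conjugated by [c], which is homologous to [- Yh b], while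
    [xg b], which crosses its path, is multiplied by a conjugate of the boundary
    of the handle [a]. The three effects are the three leaves of the tripod. *)
Lemma realized_push a b : b = a.+1 :> nat ->
  realized_tripod (Xh a) (Yh a) (Yh b).
Proof.
move=> ba; have ab : a != b by rewrite -val_eqE /=; lia.
pose z : F := ((xg b)^-1 * (yg b)^-1 * xg b)%g.
pose ca := handle a; pose c : F := (ca * z)%g.
have [] := @mapping_class_on_pair g a b
  (xg a ^ c)%g (yg a ^ c)%g (xg b * ca ^ z)%g (yg b)
  (xg a ^ c^-1)%g (yg a ^ c^-1)%g (xg b * ca^-1)%g (yg b) ba.
- set phi := fg_ext _; have phiM : {morph phi : u v / (u * v)%g} := fg_extM _.
  have phiR := gmorphR phiM; have phiJ := gmorphJ phiM; have phiV := gmorphV phiM.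
  have phia : phi ca = (ca ^ c)%g.
    by rewrite /ca /handle phiR /phi !on_pairE // -conjRg.
  have phiz : phi z = (z ^ c)%g.
    by rewrite /z !(phiM, phiV) /phi !on_pairE // /c /conjg /z !gnorm.
  have phic : phi c = c.
    by rewrite {1}/c phiM phia phiz -conjMg -/c conjgE mulKg.
  split; rewrite ?phiJ; last by rewrite /phi !on_pairE.
  + by rewrite phiV phic /phi !on_pairE // conjgK.
  + by rewrite phiV phic /phi !on_pairE // conjgK.
  + by rewrite phiM phiV phia /phi !on_pairE // /c /conjg !gnorm.
- set psi := fg_ext _; have psiM : {morph psi : u v / (u * v)%g} := fg_extM _.
  have psiR := gmorphR psiM; have psiJ := gmorphJ psiM; have psiV := gmorphV psiM.
  have psia : psi ca = (ca ^ c^-1)%g.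
    by rewrite /ca /handle psiR /psi !on_pairE // -conjRg.
  have psiz : psi z = (z ^ c^-1)%g.
    by rewrite /z !(psiM, psiV) /psi !on_pairE // /c /conjg /z !gnorm.
  have psic : psi c = c.
    by rewrite {1}/c psiM psia psiz -conjMg -/c conjgE invgK mulgV mulg1.
  split; rewrite ?psiJ; last by rewrite /psi !on_pairE.
  + by rewrite psic /psi !on_pairE // conjgKV.
  + by rewrite psic /psi !on_pairE // conjgKV.
  + by rewrite psiM psiJ psia psiz /psi !on_pairE // /c /conjg !gnorm.
- have -> : handle b = (z * yg b)%g by rewrite /handle /commg /conjg /z !gnorm.
  rewrite -conjRg -!/(handle _) -/ca.
  by rewrite /c; move: (ca) => d; rewrite /commg /conjg /z !gnorm.
move=> h hE; exists h; apply: has_johnson_gen => [||s]; first exact: mc_mul.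
  exact: tree_derD.
have abc : ab_class c = - Yh b.
  have ca0 : ab_class ca = 0 := ab_class_comm _ _.
  rewrite /c ab_classM ca0 add0r /z !ab_classM !ab_classV !ab_class_gen.
  by rewrite addrAC addNr sub0r.
have grab : gr_class 2 (lie_br (lie_gen (Xh a)) (lie_gen (Yh a))) ca.
  have := gr_class_br (gr_class_gen (xg a)) (gr_class_gen (yg a)).
  by rewrite !ab_class_gen.
have grc (u : F) : gr_class 2 (- lie_br (lie_gen (ab_class u)) (lie_gen (Yh b)))
    (u^-1 * u ^ c)%g.
  have := gr_class_br (gr_class_gen u) (gr_class_gen c).
  by rewrite abc lie_genN lie_brNr.
rewrite hE tripod_der; case: s => j /=; rewrite -/(Xh j) -/(Yh j) !omegaE.
  case: eqP => [->|_].
    rewrite (negPf ab) !mulr0z addr0 add0r mulr1z lie_brC.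
    by have := grc (xg a); rewrite ab_class_gen.
  case: eqP => [->|_]; rewrite !mulr0z ?mulr1z !add0r.
    by rewrite mulKg; apply: gr_classJ.
  by rewrite mulVg; apply: gr_class_zero.
rewrite !mulr0z !addr0; case: eqP => [->|_].
  rewrite mulrN1z; by have := grc (yg a); rewrite ab_class_gen.
by rewrite mulr0z; case: eqP => [->|_]; rewrite mulVg; apply: gr_class_zero.
Qed.
End Generators.

Section Trees.
Variable g : nat.
Local Notation F := (surface_group g).
Local Notation H := (H_surface g).
Local Notation LH := (free_lie H).
Implicit Types (a b c i j : 'I_g) (u : F) (t v : H) (A B : LH).

Lemma realized_xyy a b : a != b -> realized_tripod (Xh a) (Yh a) (Yh b).
Proof.
move: a b; apply: adjacent_pair_ind => [i j a b ij|a b]; last exact: realized_push.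
move/(realized_tripod_conj (tperm_action ij)).
by rewrite permH_tperm_x !permH_tperm_y.
Qed.

(** The twist along [Yh a - Yh c] replaces the leaf [Xh a] by that class, whose
    part [Yh a] does not contribute. *)
Lemma realized_yyy a b c : a != b -> a != c -> b != c ->
  realized_tripod (Yh a) (Yh b) (Yh c).
Proof.
move=> ab ac bc; move: a c ac b ab bc.
apply: (adjacent_pair_ind (P := fun a c => forall b, a != b -> b != c ->
  realized_tripod (Yh a) (Yh b) (Yh c))) => [i j a c ij hP b ab bc|a c ca b ab bc].
  have := hP (tperm i j b); rewrite -(inj_eq (@perm_inj _ (tperm i j)) a) tpermK.
  rewrite -(inj_eq (@perm_inj _ (tperm i j)) _ c) tpermK => /(_ ab bc).
  move/(realized_tripod_conj (tperm_action ij)).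
  by rewrite !permH_tperm_y tpermK.
have ac : a != c by rewrite -val_eqE /=; lia.
have om (w : H) : omega w (Yh a - Yh c) = omega w (Yh a) - omega w (Yh c).
  by rewrite (add_morphB (omegaDr w)).
have h : realized_tripod (Yh a - Yh c) (Yh a) (Yh b).
  apply: realized_tripod_transvection (transvection_yy ca) _ _ _ (realized_xyy ab).
  - by rewrite om !omega_yy.
  - by rewrite om !omega_yy.
  - by left; rewrite om !omega_xy eqxx (negPf ac).
have {h} := realized_tripodD (realized_tripodN h) (realized_tripod_xx (Yh a) (Yh b)).
rewrite opprB subrK.
by move/realized_tripod_cycle/realized_tripod_cycle.
Qed.

Lemma realized_yyx a b c : realized_tripod (Yh a) (Yh b) (Xh c).
Proof.
have [->|ab] := eqVneq a b; first exact: realized_tripod_xx.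
apply/realized_tripod_cycle/realized_tripod_cycle.
have [<-|ac] := eqVneq a c; first exact: realized_xyy.
have [<-|bc] := eqVneq b c.
  by apply/realized_tripod_swap/realized_xyy; rewrite eq_sym.
apply: (@realized_tripod_transvection _ _ (Yh c)) (transvection_x c) _ _ _ _.
- by rewrite omega_yx (negPf ac).
- by rewrite omega_yx (negPf bc).
- by right; rewrite omega_yx eqxx.
- by apply: realized_yyy; rewrite // eq_sym.
Qed.

(** The bracket of the derivation of a tree that has exactly one leaf [Yh c]
    with that of the tripod with leaves [Yh a], [Yh b] and [Xh c] glues the
    two trees together along these leaves. *)
Lemma realized_glue k a b c w d : (0 < k)%N -> c \notin rcons w d ->
  realized_tree k (lie_gen (Yh c)) (rnorm (@Yh g) w d) ->
  realized_tree k.+1 (lie_gen (Yh a)) (rnorm (@Yh g) (b :: w) d).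
Proof.
move=> k0 cw h; set R := rnorm (@Yh g) w d in h *.
have cDl := @contractDl g; have cDr := @contractDr g.
have := realized_comm k0 (ltn0Sn 0) (tree_derD _ _) (tree_derD _ _) h
  (realized_yyx a b c).
rewrite addn1; apply: realized_ext => t.
set tau := tree_der _ _; set sigma := tree_der _ _.
have tauD : {morph tau : x y / x + y} := tree_derD _ _.
have sigmaD : {morph sigma : x y / x + y} := tree_derD _ _.
have dtD := lie_derD tauD; have dsD := lie_derD sigmaD.
(* Contraction with a longitude, or with a meridian other than those of the
   leaves of [R], annihilates [R]. *)
have cutR0 s B : (forall j, j \in rcons w d -> omega s (Yh j) = 0) ->
    cut (contract s) R B = 0.
  rewrite /R; elim: (w) B => [|j v IH] B hs /=.
    by rewrite cut_gen // /contract hs ?mulr0z // inE.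
  rewrite cut_br // cut_gen // /contract hs ?inE ?eqxx // mulr0z add0r.
  by rewrite IH // => i iv; apply: hs; rewrite inE iv orbT.
have tau_y j : tau (Yh j) = 0.
  rewrite /tau /tree_der /tree cutR0 => [|i _]; last exact: omega_yy.
  by rewrite cut_gen // /contract omega_yy mulr0z addr0.
have tau_xc : tau (Xh c) = R.
  rewrite /tau /tree_der /tree cutR0 ?cut_gen // => [|i iw].
    by rewrite /contract omega_xy eqxx mulr1z addr0.
  by rewrite omega_xy; case: eqP iw cw => // <- ->.
have sigma_y j : sigma (Yh j) = if j == c then - lie_br (lie_gen (Yh a)) (lie_gen (Yh b)) else 0.
  rewrite /sigma tripod_der !omega_yy omega_yx !mulr0z !add0r.
  by case: eqP => _; rewrite ?mulrN1z ?mulr0z.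
have dsR (v : seq 'I_g) : c \notin rcons v d -> lie_der sigma (rnorm (@Yh g) v d) = 0.
  elim: v => [|j v IH]; rewrite /= inE => cv.
    by rewrite lie_der_gen // sigma_y eq_sym (negPf cv).
  move: cv; rewrite negb_or => /andP[cj cv].
  by rewrite lie_der_br // lie_der_gen // sigma_y eq_sym (negPf cj) IH // lie_br0l lie_br0r addr0.
have ds_cut s B : lie_der sigma (cut (contract s) R B) =
    cut (contract s) R (lie_der sigma B).
  rewrite /R; elim: (w) cw B => [|j v IH] /= cw B.
    by rewrite !cut_gen // /contract (add_morphMz dsD).
  move: cw; rewrite inE negb_or => /andP[cj cv].
  rewrite !cut_br // dsD IH // !cut_gen // /contract (add_morphMz dsD).
  rewrite !lie_der_br // lie_der_gen // dsR // lie_br0l add0r.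
  by rewrite sigma_y eq_sym (negPf cj) lie_br0r addr0.
rewrite [tau t]/tree_der /tree dsD ds_cut cut_gen //.
have -> : lie_der sigma (contract t (Yh c) R) = 0.
  by rewrite /contract (add_morphMz dsD) dsR // mul0rz.
rewrite lie_der_gen // sigma_y eqxx add0r cutNr // opprK.
rewrite /sigma tripod_der !dtD !(add_morphMz dtD) !lie_der_br // !lie_der_gen //.
rewrite !tau_y tau_xc !lie_br0l !lie_br0r !add0r !addr0 mul0rz addr0.
by rewrite /tree_der /tree /= cut_br // !cut_gen // addrA.
Qed.

Lemma fresh_index (s : seq 'I_g) : (size s < g)%N -> exists c, c \notin s.
Proof.
move=> sg; apply/existsP; rewrite -negb_forall; apply/negP=> /forallP all_s.
have : (#|'I_g| <= size s)%N.
  by apply: leq_trans (card_size s); apply/subset_leq_card/subsetP=> c _.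
by rewrite card_ord leqNgt sg.
Qed.

(** A caterpillar tree is assembled from tripods. The label [c] used for the
    gluing must differ from the [size w] labels beyond the glued edge, which is
    where [size w < g] is needed. *)
Lemma realized_rnorm w a d : (0 < size w)%N -> (size w < g)%N ->
  realized_tree (size w) (lie_gen (Yh a)) (rnorm (@Yh g) w d).
Proof.
elim: w a d => [|b w IH] // a d _ wg.
case: w IH wg => [|b' w] IH wg.
  have [->|ab] := eqVneq a b; first exact: realized_tripod_xx.
  have [->|ad] := eqVneq a d.
    exact/realized_tripod_cycle/realized_tripod_cycle/realized_tripod_xx.
  have [->|bd] := eqVneq b d; last exact: realized_yyy.
  exact/realized_tripod_cycle/realized_tripod_xx.
have [|c cw] := @fresh_index (rcons (b' :: w) d); first by rewrite size_rcons.
apply: (realized_glue _ _ _ cw) => //; apply: IH => //; exact: ltnW.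
Qed.
End Trees.

(** * The action on the homology of the handlebody *)

(** The triple $(a,b,c)$ stands for the upper unitriangular matrix with [a] and
    [b] above the diagonal and [c] in the corner. *)
Definition heisenberg : Type := (int * int * int)%type.
HB.instance Definition _ := Choice.on heisenberg.

Section Heisenberg.
Implicit Types x y z : heisenberg.

Definition heis_mul x y : heisenberg :=
  (x.1.1 + y.1.1, x.1.2 + y.1.2, x.2 + y.2 + x.1.1 * y.1.2).
Definition heis_one : heisenberg := (0, 0, 0).
Definition heis_inv x : heisenberg := (- x.1.1, - x.1.2, - x.2 + x.1.1 * x.1.2).

Lemma heis_mulA : associative heis_mul.
Proof.
by move=> [[a b] c] [[a' b'] c'] [[a'' b''] c'']; congr (_, _, _) => /=; ring.
Qed.
Lemma heis_mul1 : left_id heis_one heis_mul.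
Proof. by move=> [[a b] c]; congr (_, _, _) => /=; ring. Qed.
Lemma heis_mulr1 : right_id heis_one heis_mul.
Proof. by move=> [[a b] c]; congr (_, _, _) => /=; ring. Qed.
Lemma heis_mulV : left_inverse heis_one heis_inv heis_mul.
Proof. by move=> [[a b] c]; congr (_, _, _) => /=; ring. Qed.
Lemma heis_mulrV : right_inverse heis_one heis_inv heis_mul.
Proof. by move=> [[a b] c]; congr (_, _, _) => /=; ring. Qed.

HB.instance Definition _ := isGroup.Build heisenberg
  heis_mulA heis_mul1 heis_mulr1 heis_mulV heis_mulrV.

Lemma heis_commg x y : commg x y = (0, 0, x.1.1 * y.1.2 - y.1.1 * x.1.2).
Proof.
case: x y => [[a b] c] [[a' b'] c'].
by congr (_, _, _) => /=; ring.
Qed.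
End Heisenberg.

Lemma ab_class_sum (T : finType) (v : free_ab T) :
  v = \sum_t ab_gen t *~ v t.
Proof.
apply/ffunP=> s; rewrite sum_ffunE (bigD1 s) //= big1 ?addr0 => [|t ts].
  by rewrite ffunMzE ffunE eqxx intz.
by rewrite ffunMzE ffunE eq_sym (negPf ts) mul0rz.
Qed.

Section HandlebodyAction.
Variable g : nat.
Local Notation F := (surface_group g).
Local Notation H := (H_surface g).

(** The sum is the central coordinate of the image of [h (boundary_word g)]
    under the homomorphism to the Heisenberg group that is nontrivial on
    [xg i] and [yg j] only, and [h] fixes [boundary_word g]. *)
Lemma boundary_form (h : mapping_class g) (i j : 'I_g) :
  \sum_(m < g) (ab_class (h (xg m)) (inl i) * ab_class (h (yg m)) (inr j) -
    ab_class (h (yg m)) (inl i) * ab_class (h (xg m)) (inr j)) = (i == j)%:R.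
Proof.
pose chi : F -> heisenberg := fg_ext (fun s => match s with
  | inl m => ((m == i)%:R, 0, 0) : heisenberg
  | inr m => (0, (m == j)%:R, 0) : heisenberg end).
have chiM : {morph chi : u v / (u * v)%g} := fg_extM _.
have chiE u : (chi u).1 = (ab_class u (inl i), ab_class u (inr j)).
  elim/free_group_ind2: u => [|s|u v hu hv|u hu].
  - by rewrite (gmorph1 chiM) ab_class1 !ffunE.
  - by rewrite /chi fg_ext_gen ab_class_gen !ffunE; case: s => m; rewrite eq_sym.
  - by rewrite chiM ab_classM !ffunE /= hu hv.
  - by rewrite (gmorphV chiM) ab_classV !ffunE /= hu.
pose form (f : F -> F) := \sum_(m < g)
  (ab_class (f (xg m)) (inl i) * ab_class (f (yg m)) (inr j) -
   ab_class (f (yg m)) (inl i) * ab_class (f (xg m)) (inr j)).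
have formE f : {morph f : u v / (u * v)%g} ->
    chi (f (boundary_word g)) = (0, 0, form f).
  move=> fM; have cfM : {morph chi \o f : u v / (u * v)%g}.
    by move=> u v; rewrite /= fM chiM.
  rewrite -[LHS]/((chi \o f) _) (big_morph _ cfM (gmorph1 cfM)).
  transitivity (\prod_(m < g) ((0, 0,
    ab_class (f (xg m)) (inl i) * ab_class (f (yg m)) (inr j) -
    ab_class (f (yg m)) (inl i) * ab_class (f (xg m)) (inr j)) : heisenberg))%g.
    apply: eq_bigr => m _; rewrite (gmorphR cfM) heis_commg /=.
    by rewrite !chiE.
  apply/esym; rewrite /form.
  apply: (big_morph (fun z : int => (0, 0, z) : heisenberg)) => [x y|//].
  by congr (_, _, _) => /=; ring.
have := formE h (mc_mul h); rewrite mc_boundary (formE id (fun _ _ => erefl)).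
case=> e; rewrite -[LHS]/(form h) -e /form (bigD1 i) //= big1 ?addr0 => [|m mi].
  rewrite !ab_class_gen -!/(Xh _) -!/(Yh _) /Xh /Yh.
  rewrite ab_gen_xx ab_gen_yy ab_gen_yx mul0r subr0 eqxx mul1r.
  by rewrite eq_sym.
rewrite !ab_class_gen ab_gen_xx ab_gen_yx mul0r subr0 eq_sym (negPf mi).
exact: mul0r.
Qed.

Lemma H_projD : {morph (@H_proj g) : x y / x + y}.
Proof. by move=> x y; apply/ffunP=> j; rewrite !ffunE. Qed.

Lemma H_liftD : {morph (@H_lift g) : v w / v + w}.
Proof. by move=> v w; apply/ffunP=> -[j|j]; rewrite !ffunE ?addr0. Qed.

Definition section_y : handlebody_group g -> F := fg_ext (@yg g).

Lemma i_star_section u : i_star (section_y u) = u.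
Proof.
rewrite /section_y /i_star; elim/free_group_ind2: u => [|j|u v hu hv|u hu].
- by rewrite !fg_ext1.
- by rewrite !fg_ext_gen.
- by rewrite !fg_extM hu hv.
- by rewrite !fg_extV hu.
Qed.

(** An element of the Lagrangian filtration acts trivially on the homology of
    the handlebody, because its action on the homology of the surface is
    symplectic and fixes the Lagrangian pointwise. *)
Lemma in_FL_homology k (h : mapping_class g) u : in_FL k h ->
  ab_class (i_star (h (section_y u))) = ab_class u.
Proof.
move=> hk; have hx m : ab_class (h (xg m)) = Xh m.
  by have [_ /ab_classP ->] := hk m; rewrite ab_class_gen.
have hy m j : ab_class (h (yg m)) (inr j) = (m == j)%:R.
  rewrite -(boundary_form h m j) (bigD1 m) //= big1 ?addr0 => [|n nm].
    by rewrite hx /Xh ab_gen_xx ab_gen_xy eqxx mulr0 subr0 mul1r.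
  by rewrite hx /Xh ab_gen_xx ab_gen_xy mulr0 subr0 eq_sym (negPf nm) mul0r.
have fM : {morph (fun u => i_star (h (section_y u))) : u v / (u * v)%g}.
  by move=> v w; rewrite /section_y fg_extM mc_mul /i_star fg_extM.
elim/free_group_ind2: u => [|m|u v hu hv|u hu].
- by rewrite (gmorph1 fM) !ab_class1.
- rewrite /section_y fg_ext_gen -H_proj_class; apply/ffunP=> j.
  by rewrite ffunE hy ab_class_gen ffunE eq_sym.
- by rewrite fM !ab_classM hu hv.
- by rewrite (gmorphV fM) !ab_classV hu.
Qed.
End HandlebodyAction.

(** * The homomorphism $J^L_k$ *)

Section JL.
Variables g k : nat.
Hypothesis k_gt0 : (0 < k)%N.
Local Notation F := (surface_group g).
Local Notation H := (H_surface g).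
Local Notation V := (H_handlebody g).
Local Notation D := (D_group V k).
Local Notation T := (tensor V (lie_part V k.+1)).

Let pD := @H_projD g.

Let iM : {morph (@i_star g) : u v / (u * v)%g}.
Proof. exact: fg_extM. Qed.

Lemma i_star_x (j : 'I_g) : i_star (xg j) = 1%g.
Proof. by rewrite /i_star fg_ext_gen. Qed.

Lemma dualityB (x y : T) (l : H) :
  duality (x - y) l = duality x l - duality y l.
Proof.
apply: tensor_liftB => [v w m|v m m']; last by rewrite mulrzDl.
by rewrite H_liftD omegaDr mulrzDr.
Qed.

Lemma duality0 (l : H) : duality (0 : T) l = 0.
Proof. by rewrite -(subrr (0 : T)) dualityB subrr. Qed.

Lemma dualityD (l : H) : {morph (fun x : T => duality x l) : x y / x + y}.
Proof.
move=> x y; rewrite -{1}[y]opprK -[- y]sub0r.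
by rewrite !dualityB duality0 sub0r opprK.
Qed.

Lemma duality_pure v (m : lie_part V k.+1) (l : H) :
  duality (pure v m : T) l = m *~ omega l (H_lift v).
Proof.
apply: tensor_lift_pure => [u w n|u n n']; last by rewrite mulrzDl.
by rewrite H_liftD omegaDr mulrzDr.
Qed.

(** If [i_star lambda] is trivial then [i_star (h lambda)] is the image of the
    shift $\lambda^{-1}h(\lambda)$, whose class is given by [tau]. *)
Lemma johnson_JL (h : mapping_class g) tau (d : D) : has_johnson k h tau ->
  (forall l, in_L l ->
    lie_map (@H_proj g) (tau l) = lie_part_val (duality (D_val d) l)) ->
  is_JL h d.
Proof.
move=> hj taud; have proj l u : in_L l -> ab_class u = l ->
    gr_class k.+1 (duality (D_val d) l) (i_star (u^-1 * h u)%g).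
  move=> lL ul; rewrite -taud //.
  apply: gr_class_map (iM) pD (@H_proj_class g) _ _ _ _.
  by rewrite -ul.
split=> [j|l lL lambda il ll].
- split; last first.
    by apply/eqm_sym; apply: lcs_le (gr_class_lcs (hj (xg j))).
  have /gr_class_lcs : gr_class k.+1 (lie_map (@H_proj g) (tau (ab_class (xg j))))
      (i_star ((xg j)^-1 * h (xg j))%g).
    exact: gr_class_map (iM) pD (@H_proj_class g) _ _ _ (hj _).
  by rewrite iM (gmorphV iM) i_star_x invg1 mul1g.
- by have := proj l lambda lL ll; rewrite iM (gmorphV iM) il invg1 mul1g.
Qed.

(** For [lambda] in the kernel of [i_star], the element [h' lambda] is the
    product of another element of the kernel and of the lift of
    [i_star (h' lambda)] by the longitudes. The map [h] sends the first factor
    to a class given by [d], and it preserves the class of the second one since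
    it acts trivially on the homology of the handlebody. *)
Lemma is_JL_comp (h h' : mapping_class g) (d d' : D) :
  is_JL h d -> is_JL h' d' -> is_JL (mc_comp h h') (d + d').
Proof.
move=> [hk hd] [hk' hd'].
have main l : in_L l -> forall lambda, i_star lambda = 1%g ->
    ab_class lambda = l -> ab_class (h' lambda) = l ->
    gr_class k.+1 (duality (D_val (d + d')) l) (i_star (h (h' lambda))).
  move=> lL lambda il ll l'l; set mu := h' lambda.
  have cmu := hd' l lL lambda il ll; rewrite -/mu in cmu.
  pose c := section_y (i_star mu); pose nu := (mu * c^-1)%g.
  have sM : {morph (@section_y g) : u v / (u * v)%g} := fg_extM _.
  have c0 : ab_class c = 0.
    apply: ab_class_eq1; apply: lcs_morph (sM) _ _ _.
    by apply: lcs_le (gr_class_lcs cmu).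
  have inu : i_star nu = 1%g.
    by rewrite iM (gmorphV iM) i_star_section mulgV.
  have abnu : ab_class nu = l by rewrite ab_classM ab_classV c0 subr0.
  have -> : h mu = (h nu * h c)%g by rewrite -mc_mul mulgVK.
  rewrite iM dualityD; apply: gr_classM; first exact: hd.
  pose phi u := i_star (h (section_y u)).
  have phiM : {morph phi : u v / (u * v)%g}.
    by move=> u v; rewrite /phi sM mc_mul iM.
  rewrite -[h c]/(h (section_y (i_star mu))) -/(phi _) -[X in gr_class _ X]lie_map_id.
  apply: gr_class_map (phiM) _ _ _ _ _ cmu => // u.
  by rewrite (in_FL_homology _ hk).
have abh' l lambda : in_L l -> ab_class lambda = l -> ab_class (h' lambda) = l.
  move=> lL ll; pose p (t : H) := \sum_s ab_class (h' (fgen s)) *~ t s.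
  have pD' : {morph p : x y / x + y}.
    by move=> x y; rewrite -big_split; apply: eq_bigr => s _; rewrite ffunE mulrzDr.
  rewrite (ab_class_morph (mc_mul h') pD') => [|s].
    rewrite ll [RHS]ab_class_sum; apply: eq_bigr => -[j|j] _.
      by have [_ /ab_classP ->] := hk' j; rewrite ab_class_gen.
    have := congr1 (fun v : V => v j) lL; rewrite !ffunE => ->.
    by rewrite !mulr0z.
  rewrite /p (bigD1 s) //= big1 ?addr0 ?ffunE ?eqxx // => s' ss'.
  by rewrite ffunE (negPf ss').
split=> [j|l lL lambda il ll]; last exact: main (abh' _ _ lL ll).
have jL : in_L (Xh j) by apply/ffunP=> i; rewrite !ffunE.
split.
  apply: gr_class_lcs (main _ jL _ (i_star_x j) (ab_class_gen _) _).
  exact: abh' jL (ab_class_gen _).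
apply: eqm_trans (proj2 (hk j)).
exact: eqm_morph (mc_mul h) _ _ _ (proj2 (hk' j)).
Qed.
End JL.

(** * Generators of the target and their realization *)

Section Image.
Variables g k : nat.
Hypothesis k_gt0 : (0 < k)%N.
Hypothesis k_lt_g : (k < g)%N.
Local Notation H := (H_surface g).
Local Notation V := (H_handlebody g).
Local Notation D := (D_group V k).
Local Notation T := (tensor V (lie_part V k.+1)).
Local Notation y := (fun j : 'I_g => ab_gen j : V).
Local Notation pf := (@pure_of V k).

Let fDl := @pure_ofDl V k.
Let fDr := @pure_ofDr V k.

Definition JLt (x : T) : Prop := exists2 d : D, D_val d = x & JL_image d.

Lemma JLt0 : JLt 0.
Proof.
exists 0 => //; exists (mc_id g); apply: (johnson_JL k_gt0 (tau := fun=> 0)).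
  by move=> u; rewrite /= mulVg; apply: gr_class_zero.
by move=> l _; rewrite (add_morph0 (lie_mapD (@H_projD g))) duality0.
Qed.

Lemma JLtD x x' : JLt x -> JLt x' -> JLt (x + x').
Proof.
move=> [d <- [h hd]] [d' <- [h' hd']]; exists (d + d') => //.
by exists (mc_comp h h'); apply: is_JL_comp.
Qed.

Lemma bracket_map_tree A B : bracket_map (tree pf A B) = 0.
Proof.
rewrite /tree (bracket_mapD) !bracket_map_cut (lie_brC B).
by rewrite (add_morphN (@lie_compD V _ _)) subrr.
Qed.

Lemma bracket_map_cutxx A : bracket_map (cut pf A A) = 0.
Proof. by rewrite bracket_map_cut lie_brxx (add_morph0 (@lie_compD V _ _)). Qed.

Definition cutD A : D := DGroup (introT eqP (bracket_map_cutxx A)).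
Definition treeD A B : D := DGroup (introT eqP (bracket_map_tree A B)).

Lemma H_proj_y j : H_proj (Yh j) = y j.
Proof. by apply/ffunP=> i; rewrite !ffunE. Qed.

(** Lift the labels of the tree to longitudes and realize the tree in the
    Johnson filtration. Contraction with a class of the Lagrangian only sees the
    images of the labels in the homology of the handlebody, so the projection to
    the handlebody gives the original tree. *)
Lemma JLt_tree_rnorm a w c :
  JLt (tree pf (lie_gen (y a)) (rnorm y w c)) /\
  JLt (- tree pf (lie_gen (y a)) (rnorm y w c)).
Proof.
set x := tree pf _ _.
have [wk|wk] := eqVneq (size w) k; last first.
  have -> : x = 0; last by rewrite oppr0; split; apply: JLt0.
  have ha := lie_homog_gen (y a); have hw := rnorm_homog y w c.
  rewrite /x /tree (cut_wrong_degree ha hw) ?(cut_wrong_degree hw ha) ?addr0 //.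
    by apply: contra wk => /eqP e; apply/eqP; lia.
have pD := @H_projD g.
pose tau := tree_der (lie_gen (Yh a)) (rnorm (@Yh g) w c).
have rtau : realized k tau.
  by rewrite -wk; apply: realized_rnorm; rewrite wk.
have rnorm_proj : lie_map (@H_proj g) (rnorm (@Yh g) w c) = rnorm y w c.
  rewrite /rnorm; elim: (w) => [|b v IH] /=; first by rewrite lie_map_gen // H_proj_y.
  by rewrite lie_map_br // IH lie_map_gen // H_proj_y.
have dual_tau l : in_L l ->
    lie_map (@H_proj g) (tau l) = lie_part_val (duality x l).
  have [h hj] := rtau; move=> lL; pose f' (v : V) (B : free_lie V) := B *~ omega l (H_lift v).
  have f'Dl u v B : f' (u + v) B = f' u B + f' v B.
    by rewrite /f' H_liftD omegaDr mulrzDr.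
  have f'Dr v : {morph f' v : B C / B + C} by move=> B C; rewrite /f' mulrzDl.
  have tauE : lie_map (@H_proj g) (tau l) = tree f' (lie_gen (y a)) (rnorm y w c).
    rewrite /tau /tree_der (tree_natural (@contractDl g l) (@contractDr g l)
      f'Dl f'Dr pD (lie_mapD pD)); last first.
      by move=> v B; rewrite /contract /f' (add_morphMz (lie_mapD pD)) omega_lift.
    by rewrite lie_map_gen // H_proj_y rnorm_proj.
  have hom : lie_homog k.+1 (lie_map (@H_proj g) (tau l)).
    have [u <-] := ab_class_surj l; apply: gr_class_homog.
    apply: gr_class_map (fg_extM _) pD (@H_proj_class g) _ _ _ (hj u).
  rewrite tauE in hom *.
  pose k1 : 'I_k.+3 := Ordinal (leqnSn k.+2).
  have cD := @lie_compD V _ k1.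
  have <- : lie_comp k1 (tree f' (lie_gen (y a)) (rnorm y w c)) =
      tree f' (lie_gen (y a)) (rnorm y w c) by rewrite (lie_comp_id _ hom) eqxx.
  pose f1 v B := lie_comp k1 (f' v B).
  have f1Dl u v B : f1 (u + v) B = f1 u B + f1 v B by rewrite /f1 f'Dl cD.
  have f1Dr v : {morph f1 v : B C / B + C} by move=> B C; rewrite /f1 f'Dr cD.
  rewrite (tree_image f'Dl f'Dr f1Dl f1Dr cD) //; apply/esym.
  apply: (tree_image (G := fun t : T => lie_part_val (duality t l))) => //.
    by move=> t t'; rewrite dualityD.
  move=> v B; rewrite duality_pure /f1 /f' (add_morphMz cD).
  exact: (raddfMz (val : lie_part V k.+1 -> free_lie V)).
split.
  exists (treeD (lie_gen (y a)) (rnorm y w c)) => //.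
  by have [h hj] := rtau; exists h; apply: johnson_JL hj _.
exists (- treeD (lie_gen (y a)) (rnorm y w c)) => //.
have [h hj] := realizedN k_gt0 rtau; exists h; apply: johnson_JL hj _ => // l lL.
rewrite (add_morphN (lie_mapD pD)) dual_tau //.
by rewrite (add_morphN (@dualityD g k l)).
Qed.

Let y_span (v : V) : zspan (fun u => exists i, u = y i) v.
Proof.
rewrite (ab_class_sum v); apply: (big_ind (zspan _)) => [||j _].
- exact: zspan0.
- exact: zspanD.
- have yX n : zspan (fun u => exists i, u = y i) (y j *+ n).
    elim: n => [|n IH]; first exact: zspan0.
    by rewrite mulrS; apply: zspanD IH; apply: zspan_mem; exists j.
  by case: (v j) => n; [exact: yX | exact/zspanN/yX].
Qed.

(** By sliding along its edges a tree is cut at a leaf, and by multilinearity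
    the rest of it is a right-normed bracket of basis elements. *)
Lemma JLt_tree A B : JLt (tree pf A B).
Proof.
elim/free_lie_ind: A B => [v||A A' hA hA'|A hA|A A' hA hA'] B.
- elim: (y_span v) B => {v} [_ [a ->]||u v _ hu _ hv|u _ hu] B.
  + suff : JLt (tree pf (lie_gen (y a)) B) /\ JLt (- tree pf (lie_gen (y a)) B).
      by case.
    elim: (rnorm_span y_span B) => {B} [_ [w [c ->]]||B C _ [] h1 h2 _ [] h3 h4|B _ []].
    * exact: JLt_tree_rnorm.
    * by rewrite tree0r // oppr0; split; apply: JLt0.
    * by rewrite treeDr // opprD; split; apply: JLtD.
    * by rewrite treeNr // opprK.
  + by rewrite lie_gen0 tree0l //; apply: JLt0.
  + by rewrite lie_genD treeDl //; apply: JLtD.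
  + by rewrite lie_genN treeNl // -treeNr.
- by rewrite tree0l //; apply: JLt0.
- by rewrite treeDl //; apply: JLtD.
- by rewrite treeNl // -treeNr.
- by rewrite tree_slide.
Qed.

Lemma JL_imageP (d : D) : JLt (D_val d) <-> JL_image d.
Proof.
split=> [[d' /val_inj <-] //|hd]; by exists d.
Qed.

(** Doubling turns [cut pf A A], which is not a tree, into the tree that joins
    two copies of [A] at their roots. *)
Lemma JL_double (d : D) : JL_image (d *+ 2).
Proof.
apply/JL_imageP; have -> : D_val (d *+ 2) = D_val d *+ 2 by rewrite !mulr2n.
suff : JLt (D_val d *+ 2) /\ JLt (- (D_val d *+ 2)) by case.
have /D_span : bracket_map (D_val d) = 0 by case: d => x /= /eqP.
elim=> {d} [_ [A ->]||u v _ [] h1 h2 _ [] h3 h4|u _ [] h1 h2].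
- rewrite mulr2n -/(tree pf A A) -treeNl //; split; exact: JLt_tree.
- by rewrite mul0rn oppr0; split; apply: JLt0.
- by rewrite mulrnDl opprD; split; apply: JLtD.
- by rewrite mulNrn opprK.
Qed.

(** Sums suffice, because $-b = b + 2(-b)$ and doubles are in the image. *)
Lemma JL_subgroup : is_subgroup (@JL_image g k).
Proof.
split; first exact/(JL_imageP 0)/JLt0.
move=> a b ha hb.
have -> : a - b = a + b + (- b) *+ 2 by rewrite mulr2n addrA addrK.
apply/JL_imageP/JLtD; last exact/JL_imageP/JL_double.
by apply/JLtD; apply/JL_imageP.
Qed.

Lemma JL_zspan (d : D) : zspan (@JL_image g k) d -> JL_image d.
Proof.
have [h0 hB] := JL_subgroup.
have hN (a : D) : JL_image a -> JL_image (- a).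
  by move=> ha; rewrite -sub0r; apply: hB.
elim=> {d} // [a b _ ha _ hb|a _ /hN //].
by rewrite -[b]opprK; apply/hB/hN.
Qed.

Definition half_brackets : seq D :=
  [seq cutD (rnorm y p.1 p.2) | p : (k./2).-tuple 'I_g * 'I_g].

(** Modulo the image, [cut pf A A] is additive in [A]. For homogeneous [A] it
    vanishes unless [A] has half the degree $k+2$. *)
Lemma D_generated (d : D) :
  zspan (fun e => JL_image e \/ ~~ odd k /\ e \in half_brackets) d.
Proof.
set S := fun e => _.
have lift x : zspan (fun u => exists2 e, D_val e = u & S e) x ->
    exists2 e, D_val e = x & zspan S e.
  elim=> {x} [x [e <- he]||x x' _ [e <- he] _ [e' <- he']|x _ [e <- he]].
  - by exists e => //; apply: zspan_mem.
  - by exists 0 => //; apply: zspan0.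
  - by exists (e + e') => //; apply: zspanD.
  - by exists (- e) => //; apply: zspanN.
suff : zspan (fun u => exists2 e, D_val e = u & S e) (D_val d).
  by move/lift=> [e /val_inj ->].
have /D_span : bracket_map (D_val d) = 0 by case: d => x /= /eqP.
elim=> {d} [_ [A ->]||u v _ hu _ hv|u _ hu]; [|exact: zspan0|exact: zspanD|exact: zspanN].
elim: (rnorm_span y_span A) => {A} [_ [w [c ->]]||A B _ hA _ hB|A _ hA].
- have hw := rnorm_homog y w c.
  have [e|ne] := eqVneq ((size w).+1 + (size w).+1)%N k.+2; last first.
    by rewrite (cut_wrong_degree hw hw ne); apply: zspan0.
  have kw : k = (size w).*2 by lia.
  apply: zspan_mem; exists (cutD (rnorm y w c)) => //; right; split.
    by rewrite kw odd_double.
  have wk : size w == k./2 by rewrite kw doubleK.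
  by apply/imageP; exists (Tuple wk, c).
- by rewrite cut0l //; apply: zspan0.
- have -> : cut pf (A + B) (A + B) = cut pf A A + cut pf B B + tree pf A B.
    by rewrite cutDl // !cutDr // /tree !addrA [LHS](ACl (1*4*2*3)).
  apply: zspanD; first exact: zspanD.
  apply: zspan_mem; have [e eE he] := JLt_tree A B; exists e => //; by left.
- by rewrite cutNl // cutNr // opprK.
Qed.
End Image.

(** * Subgroups of index a power of two *)

Section Index.
Variable A : zmodType.
Implicit Types (S : A -> Prop) (a x : A).

Lemma has_index_card S (I : finType) (r : I -> A) :
  (forall a, exists! i, S (a - r i)) -> has_index S #|I|.
Proof.
move=> hr; exists (r \o enum_val) => a.
have [i [hi ui]] := hr a; exists (enum_rank i); split.
  by rewrite /= enum_rankK.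
by move=> j /= /ui ->; rewrite enum_valK.
Qed.

(** Adjoining one of the generators [q] to [S] at a time, the index is
    multiplied by one or two at each step. *)
Lemma index_power_of_2 (q : seq A) S : is_subgroup S -> (forall a, S (a *+ 2)) ->
  (forall a, zspan (fun e => S e \/ e \in q) a) ->
  exists n, has_index S (2 ^ n).
Proof.
elim: q S => [|x q IH] S [S0 SB] S2 hq.
  have SN a : S a -> S (- a) by move=> ha; rewrite -sub0r; apply: SB.
  have Sall a : S a.
    elim: (hq a) => {a} [a []//||a b _ ha _ hb|a _ /SN] //.
    by rewrite -[b]opprK; apply/SB/SN.
  exists 0%N; exists (fun=> 0) => a; exists ord0; split => // i _.
  by rewrite [i]ord1.
have SN a : S a -> S (- a) by move=> ha; rewrite -sub0r; apply: SB.
have SD a b : S a -> S b -> S (a + b).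
  by move=> ha hb; rewrite -[b]opprK; apply/SB/SN.
pose S' a := S a \/ S (a - x).
have [n [r hr]] : exists n, has_index S' (2 ^ n).
  apply: IH => [|a|a]; last 2 first.
  - by left.
  - elim: (hq a) => {a} [a||a b _ ha _ hb|a _ ha].
    + rewrite inE => -[aS|/predU1P[->|aq]]; apply: zspan_mem.
      * by left; left.
      * by left; right; rewrite subrr.
      * by right.
    + exact: zspan0.
    + exact: zspanD.
    + exact: zspanN.
  split; first by left.
  move=> a b [ha|ha] [hb|hb].
  - by left; apply: SB.
  - right; have -> : a - b - x = a - (b - x) - x *+ 2.
      by rewrite opprB mulr2n opprD !addrA [RHS](ACl (1*3*4*(2*5))) /= subrr addr0.
    by apply: (SB _ _ (SB _ _ ha hb)).
  - by right; rewrite addrAC; apply: SB.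
  - left; have -> : a - b = (a - x) - (b - x) by rewrite opprB addrA subrK.
    exact: SB.
have [xS|xS] := pselect (S x).
  exists n, r => a; have S'S b : S' b -> S b.
    by case=> // /SD/(_ xS); rewrite subrK.
  have [i [hi ui]] := hr a; exists i; split; first exact: S'S.
  by move=> j hj; apply: ui; left.
exists n.+1; have -> : (2 ^ n.+1)%N = #|{: bool * 'I_(2 ^ n)}|.
  by rewrite card_prod card_bool card_ord expnS.
apply: (has_index_card (r := fun p : bool * 'I_(2 ^ n) => r p.2 + (if p.1 then x else 0))) => a.
have [i [hi ui]] := hr a.
have [b hb] : exists b : bool, S (a - (r i + (if b then x else 0))).
  by case: hi => hi; [exists false; rewrite addr0 | exists true; rewrite opprD addrA].
exists (b, i); split=> // -[b' j] /= hj.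
have ji : i = j.
  apply: ui; case: b' hj => hj; first by right; rewrite -addrA -opprD.
  by left; rewrite addr0 in hj.
rewrite -{j}ji in hj *; congr (_, _).
have := SB _ _ hb hj; rewrite opprB addrC addrA subrK [r i + _]addrC addrKA.
by case: b b' {hb hj} => [] [] //=; rewrite ?subr0 ?sub0r // => /SN; rewrite ?opprK.
Qed.
End Index.

Theorem theorem1 (k g : nat) (k_ge1 : (1 <= k)%N) (k_lt_g : (k < g)%N) :
  [/\ forall d : D_group (H_handlebody g) k, JL_image (d *+ 2),
      is_subgroup (@JL_image g k),
      exists n : nat, has_index (@JL_image g k) (2 ^ n)%N
    & odd k -> forall d : D_group (H_handlebody g) k, JL_image d].
Proof.
split.
- exact: JL_double.
- exact: JL_subgroup.
- apply: (index_power_of_2 (q := half_brackets g k)) => [||d].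
  + exact: JL_subgroup.
  + exact: JL_double.
  + elim: (D_generated k_ge1 k_lt_g d) => {d} [d h||d e _ hd _ he|d _ hd].
    * by apply: zspan_mem; case: h => [|[_]]; [left|right].
    * exact: zspan0.
    * exact: zspanD.
    * exact: zspanN.
- move=> ok d; apply: JL_zspan => //.
  elim: (D_generated k_ge1 k_lt_g d) => {d} [d h||d e _ hd _ he|d _ hd].
  + by apply: zspan_mem; case: h => // -[]; rewrite ok.
  + exact: zspan0.
  + exact: zspanD.
  + exact: zspanN.
Qed.
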